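(* Let $k,K\in\mathbb N$ with $k\ge2$, $K\le k$, let $\pi:[k]\to[K]$ be a labelling function, and let $\mathsf o$ be its oddness parameter. Let $n=n(d)$ be a sequence of effective sample sizes. There exist SQ algorithms (one for each $d$) that make $O(d^k\cdot\log(n))$ queries and that, for all sufficiently large $d$, solve: 1. the Tensor PCA testing problem with $\mathsf o=0$, provided $n\gg\sqrt{d^k}$; 2. the Tensor PCA estimation problem with $\mathsf o=0$, provided $n\gg\sqrt{d^{k+2}}$; 3. the Tensor PCA testing problem and the Tensor PCA estimation problem with $\mathsf o\ge1$, provided $n\gg\sqrt{d^{k+\mathsf o}}$.
   Context: $[m]=\{1,\dots,m\}$; $\bigotimes^k\mathbb R^d$ is the set of real $d\times\cdots\times d$ tensors of order $k$; $\|\cdot\|$ is the Euclidean norm of the vector of entries. $k,K,\pi$ are fixed while $d\to\infty$. Asymptotic notation for positive sequences: $f(d)\lesssim g(d)$ means there is a constant $c$ independent of $d$ with $f(d)\le c\,g(d)$; $f(d)\ll g(d)$ (equivalently $g\gg f$) means there is $\epsilon>0$ with $f(d)\,d^\epsilon\lesssim g(d)$. Distributions. For $\boldsymbol V\in\bigotimes^k\mathbb R^d$, $D_{\boldsymbol V}$ is the law of a random tensor $\boldsymbol T$ with independent entries $T_{j_1,\dots,j_k}\sim\mathcal N(V_{j_1,\dots,j_k}/d^{k/2},1)$. $D_0$ is the law of a tensor with i.i.d. $\mathcal N(0,1)$ entries. For $\pi:[k]\to[K]$, $$\mathcal D(\pi)=\{D_{\boldsymbol V}:\ \boldsymbol V=\boldsymbol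 v_{\pi(1)}\otimes\cdots\otimes\boldsymbol v_{\pi(k)},\ \boldsymbol v_1,\dots,\boldsymbol v_K\in\mathbb R^d,\ \|\boldsymbol v_i\|=\sqrt d\ \ \forall i\in[K]\}.$$ Oddness parameter: with $s_i=|\pi^{-1}(i)|$, $\mathsf o=|\{i\in[K]: s_i\text{ is odd}\}|$. VSTAT oracle. For $D\in\{D_0\}\cup\mathcal D(\pi)$ and $n\in\mathbb N$, a $\mathsf{VSTAT}_D(n)$ oracle is any oracle that, given an arbitrary (measurable) query $q:\bigotimes^k\mathbb R^d\to[0,1]$, returns a number $\hat{\mathbb E}_Dq(\boldsymbol T)$ with $$|\hat{\mathbb E}_D q(\boldsymbol T)-\mathbb E_D q(\boldsymbol T)|\le\max\left(\frac1n,\sqrt{\frac{\mathbb E_Dq(\boldsymbol T)\,(1-\mathbb E_Dq(\boldsymbol T))}{n}}\right);$$ the response is otherwise arbitrary. SQ algorithm: an algorithm that knows $\pi$ (and $d,k,n$) and accesses the unknown distribution only through (possibly adaptive) queries to a $\mathsf{VSTAT}_D(n)$ oracle. Testing: the algorithm solves the testing problem with $n$ samples and $B$ queries if, for every $D\in\{D_0\}\cup\mathcal D(\pi)$ (unknown to it) and every $\mathsf{VSTAT}_D(n)$ oracle, it correctly decides whether $D=D_0$ or $D\in\mathcal D(\pi)$ after at most $B$ queries. Estimation: the algorithm solves the estimation problem with $n$ samples and $B$ queries if, for every $D\in\mathcal D(\pi)$ (unknown to it) and every $\mathsf{VSTAT}_D(n)$ oracle, it returns $\hat{\boldsymbol V}$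 with $\|\hat{\boldsymbol V}-\mathbb E_D\boldsymbol T\|\le\frac14$ after at most $B$ queries. *)

(* Defs.v *)
(* MathComp / MathComp-Analysis *)
From HB Require Import structures.
From mathcomp Require Import all_boot all_order all_algebra.
From mathcomp Require Import all_classical all_reals all_analysis.

Set Implicit Arguments.
Unset Strict Implicit.
Unset Printing Implicit Defensive.

Import Order.TTheory GRing.Theory Num.Theory.
Import numFieldNormedType.Exports.
Local Open Scope classical_set_scope.
Local Open Scope ring_scope.

Section product_prob.
Context {dT : measure_display} {T : measurableType dT} {R : realType}.

Definition tuple_cons n (x : T * n.-tuple T) : n.+1.-tuple T :=
  [the n.+1.-tuple T of x.1 :: x.2].

Lemma measurable_tuple_cons n : measurable_fun setT (@tuple_cons n).
Proof. exact: measurable_cons. Qed.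

HB.instance Definition _ n := isMeasurableFun.Build _ _ _ _
  (@tuple_cons n) (@measurable_tuple_cons n).

(* The law of a tuple of independent coordinates, the i-th one with law P i;
   product_probE characterizes it. *)
Fixpoint product_prob n :
    ('I_n -> probability T R) -> probability (n.-tuple T) R :=
  match n with
  | 0 => fun _ => \d_([tuple] : 0.-tuple T)
  | n'.+1 => fun P =>
      distribution (P ord0 \x product_prob (fun i => P (lift ord0 i)))%E
                   (@tuple_cons n')
  end.

Lemma product_probE n (P : 'I_n -> probability T R) (B : 'I_n -> set T) :
  (forall i, measurable (B i)) ->
  product_prob P [set t | forall i, B i (tnth t i)] = (\prod_(i < n) P i (B i))%E.
Proof.
elim: n P B => [|n IH] P B mB /=.
  rewrite big_ord0 diracE mem_set//= => -[].
  by case.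
rewrite big_ord_recl /distribution /pushforward /=.
rewrite -IH//; set C := [set t : n.-tuple T | _].
have mC : measurable C.
  rewrite (_ : C = \bigcap_(i in setT) ((@tnth n T ^~ i) @^-1` B (lift ord0 i))).
    apply: fin_bigcap_measurable; first exact: finite_finset.
    move=> i _; rewrite -[X in measurable X]setTI.
    exact: measurable_tnth.
  by apply/seteqP; split => t h i; [move=> _; exact: h|exact: (h i)].
rewrite -product_measure1E//; congr (_ _).
apply/seteqP; split => [[x t]/= h|[x t]/= [hx ht] i].
  by split => [|i]; [exact: (h ord0)|have := h (lift ord0 i); rewrite tnthS].
by case: (unliftP ord0 i) => [j ->|->]; rewrite ?tnthS; [exact: ht|].
Qed.

End product_prob.

Section asymptotics.
Context {R : realType}.
Implicit Types f g : nat -> R.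

Definition lesssim f g : Prop :=
  exists c : R, forall d, (0 < d)%N -> f d <= c * g d.

(* f << g in the polynomial sense: f d * d^eps <~ g d for some eps > 0. *)
Definition muchless f g : Prop :=
  exists2 eps : R, 0 < eps & lesssim (fun d => f d * d%:R `^ eps) g.
End asymptotics.

Section tensor_pca.
Context {R : realType} {k d : nat}.

(* The entry of a tensor at the multi-index j is its (enum_rank j)-th
   coordinate; the tuple type carries the product Borel sigma-algebra. *)
Definition tensor := #|{ffun 'I_k -> 'I_d}|.-tuple (measurableTypeR R).

Definition entry (V : tensor) (j : {ffun 'I_k -> 'I_d}) : R :=
  tnth V (enum_rank j).

Definition tensor_of (f : {ffun 'I_k -> 'I_d} -> R) : tensor :=
  [tuple f (enum_val i) | i < #|{ffun 'I_k -> 'I_d}|].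

Lemma tensor_ofE f j : entry (tensor_of f) j = f j.
Proof. by rewrite /entry tnth_mktuple enum_rankK. Qed.

Definition tensor_norm (V : tensor) : R := Num.sqrt (\sum_j entry V j ^+ 2).

(* The MathComp-Analysis norm of a row vector is the sup norm. *)
Definition vec_norm (v : 'rV[R]_d) : R := Num.sqrt (\sum_j v 0 j ^+ 2).

Definition gaussian_tensor (V : tensor) : probability tensor R :=
  product_prob (fun i =>
    normal_prob (tnth V i / d%:R `^ (k%:R / 2)) 1
      : probability (measurableTypeR R) R).

Definition null_law : probability tensor R :=
  product_prob (fun=> normal_prob 0 1 : probability (measurableTypeR R) R).

Definition spike K (pi : 'I_k -> 'I_K) (v : 'I_K -> 'rV[R]_d) : tensor :=
  tensor_of (fun j => \prod_(a < k) v (pi a) 0 (j a)).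

Definition spiked_laws K (pi : 'I_k -> 'I_K) : set (probability tensor R) :=
  [set D | exists2 v : 'I_K -> 'rV[R]_d,
     (forall i, vec_norm (v i) = Num.sqrt d%:R) &
     D = gaussian_tensor (spike pi v)].

(* The entrywise expectation of T when T has law D. *)
Definition mean_tensor (D : probability tensor R) : tensor :=
  tensor_of (fun j => fine 'E_D[fun T => entry T j]).

Record query := Query {
  query_fun :> {mfun tensor >-> measurableTypeR R};
  query_itv : forall T, 0 <= query_fun T <= 1 }.

Definition mean (D : probability tensor R) (q : query) : R := fine 'E_D[q].

(* The answer to the current query may depend on the earlier queries and
   answers, so that an oracle need not be consistent over time. *)
Definition oracle := seq (query * R) -> query -> R.

Definition vstat (D : probability tensor R) (n : nat) (O : oracle) : Prop :=
  forall h q,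
    `|O h q - mean D q| <=
      Num.max n%:R^-1 (Num.sqrt (mean D q * (1 - mean D q) / n%:R)).

(* An adaptive algorithm is a decision tree: it sees the unknown law only
   through the answers to its queries. *)
Inductive sq_algorithm (Out : Type) : Type :=
| Return of Out
| Ask of query & (R -> sq_algorithm Out).

Fixpoint run_from (Out : Type) (O : oracle) (h : seq (query * R))
    (A : sq_algorithm Out) : seq (query * R) * Out :=
  match A with
  | Return x => (h, x)
  | Ask q next => let r := O h q in run_from O (rcons h (q, r)) (next r)
  end.

Definition queries (Out : Type) (O : oracle) (A : sq_algorithm Out) : nat :=
  size (run_from O [::] A).1.

Definition output (Out : Type) (O : oracle) (A : sq_algorithm Out) : Out :=
  (run_from O [::] A).2.

Inductive verdict := Null | Spiked.

Definition solves_testing K (pi : 'I_k -> 'I_K) (n B : nat)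
    (A : sq_algorithm verdict) : Prop :=
  forall D, ([set null_law] `|` spiked_laws pi) D ->
  forall O, vstat D n O ->
  [/\ (queries O A <= B)%N,
      (D = null_law -> output O A = Null) &
      (spiked_laws pi D -> output O A = Spiked)].

Definition solves_estimation K (pi : 'I_k -> 'I_K) (n B : nat)
    (A : sq_algorithm tensor) : Prop :=
  forall D, spiked_laws pi D ->
  forall O, vstat D n O ->
  (queries O A <= B)%N /\
  tensor_norm (tensor_of (fun j =>
    entry (output O A) j - entry (mean_tensor D) j)) <= 1 / 4.

End tensor_pca.

Arguments tensor : clear implicits.
Arguments query : clear implicits.
Arguments sq_algorithm : clear implicits.

(* Labels outside the range of pi have an empty, hence even, class. *)
Definition oddness k K (pi : 'I_k -> 'I_K) : nat :=
  #|[set i : 'I_K | odd #|[set a | pi a == i]|]|.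

Section complexity.
Context {R : realType}.

Definition query_budget k (n B : nat -> nat) : Prop :=
  lesssim (fun d => (B d)%:R : R) (fun d => d%:R ^+ k * ln (n d)%:R).

(* One algorithm for each d; the constant hidden in the query budget and the
   threshold on d may depend on k, K, pi and the sequence n. *)
Definition testable k K (pi : 'I_k -> 'I_K) (n : nat -> nat) : Prop :=
  exists (A : forall d, sq_algorithm R k d verdict) (B : nat -> nat),
    query_budget k n B /\
    \forall d \near \oo, solves_testing pi (n d) (B d) (A d).

Definition estimable k K (pi : 'I_k -> 'I_K) (n : nat -> nat) : Prop :=
  exists (A : forall d, sq_algorithm R k d (tensor R k d)) (B : nat -> nat),
    query_budget k n B /\
    \forall d \near \oo, solves_estimation pi (n d) (B d) (A d).
End complexity.

Arguments testable R {k K} pi n.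
Arguments estimable R {k K} pi n.

(* Main.v *)
(* Every query has the form (1 + sin <T, W>) / 2 for a suitably normalized tensor
   W.  Under independent unit-variance Gaussian entries with mean M its
   expectation is (1 + c_W sin <M, W>) / 2 with 1/2 <= c_W <= 1, so one VSTAT
   answer determines <M, W> up to O(|W| / sqrt n).  An algorithm asks a family of
   such queries and returns anything consistent with all the answers.

   Let p be the number of pairs in a maximal matching of positions carrying equal
   labels, so that k = 2 p + o.  Tracing out the pairs of M = u_1 (x) ... and
   reading off the entries of the remaining tensor of order o takes d^o
   functionals with |W|^2 = d^p: the total squared error is of order
   d^(o + p) / n = sqrt (d^(k + o)) / n.  This suffices for testing and yields
   unit vectors w with prod_(i odd) <u_i, w_i> close to 1.  For an even class i,
   leaving one of its pairs open and contracting the odd leftovers with w gives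
   the d^2 entries of u_i u_i^T up to a factor close to 1, with total squared
   error of order d^(p + 1) / n.  The overlaps <u_i, u'_i> of two candidates that
   fit all these answers force <M, M'> to be close to 1. *)
From HB Require Import structures.
Require Import Defs.
From mathcomp Require Import all_boot all_order all_algebra.
From mathcomp Require Import all_classical all_reals all_analysis.
From mathcomp Require Import measurable_realfun ring lra zify.
Import Order.TTheory GRing.Theory Num.Theory.
Import numFieldNormedType.Exports.
Local Open Scope classical_set_scope.
Local Open Scope ring_scope.
Set Implicit Arguments.
Unset Strict Implicit.
Unset Printing Implicit Defensive.

(** * Normal laws *)

Section normal_law.
Context {R : realType}.
Local Notation mu := (@lebesgue_measure R).
Local Notation normal m := (normal_prob m 1 : probability (measurableTypeR R) R).

(** The Radon-Nikodym derivative of the normal law agrees almost everywhere with the density, since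
    both have the same integral over every measurable set. *)
Lemma ge0_integral_normal_prob (m : R) (f : R -> \bar R) :
  (forall x, 0 <= f x)%E -> measurable_fun [set: R] f ->
  (\int[normal m]_x f x = \int[mu]_x (f x * (normal_pdf m 1 x)%:E))%E.
Proof.
move=> f0 mf.
rewrite -(Radon_Nikodym_SigmaFinite.change_of_variables
  (normal_prob_dominates m 1) f0 measurableT mf).
apply: ae_eq_integral => //.
- apply: emeasurable_funM => //; apply: (measurable_int mu).
  exact: Radon_Nikodym_SigmaFinite.f_integrable (normal_prob_dominates m 1).
- apply: emeasurable_funM => //; apply/measurable_EFinP.
  exact: measurable_normal_pdf.
- apply: ae_eqe_mul2l; apply: integral_ae_eq => //=.
  + exact: Radon_Nikodym_SigmaFinite.f_integrable (normal_prob_dominates m 1).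
  + by apply/measurable_EFinP; exact: measurable_normal_pdf.
  + move=> E _ mE.
    by rewrite -(Radon_Nikodym_SigmaFinite.f_integral (normal_prob_dominates m 1)).
Qed.

(** Change of variables: Lebesgue measure is invariant under [phi] and the densities match along it.
    Serves for translations and for the reflection. *)
Lemma normal_prob_pushforward (m m' : R)
    (phi : {mfun measurableTypeR R >-> measurableTypeR R}) :
  (forall A, measurable A -> pushforward mu phi A = mu A) ->
  (forall x, normal_pdf m 1 (phi x) = normal_pdf m' 1 x) ->
  forall A, measurable A -> normal m A = pushforward (normal m') phi A.
Proof.
move=> muphi pdfphi A mA; rewrite /pushforward /= /normal_prob.
rewrite (eq_measure_integral (pushforward mu phi)); last first.
  by move=> B mB _; exact/esym/muphi.
rewrite ge0_integral_pushforward//=.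
- by apply: eq_integral => x _; rewrite pdfphi.
- by apply/measurable_funTS/measurable_EFinP; exact: measurable_normal_pdf.
- by move=> x _; rewrite lee_fin normal_pdf_ge0.
Qed.

Definition translate (c : R) : measurableTypeR R -> measurableTypeR R :=
  fun x => x + c.

Lemma measurable_translate c : measurable_fun setT (translate c).
Proof. exact: measurable_funD. Qed.

HB.instance Definition _ c := isMeasurableFun.Build _ _ _ _
  (translate c) (measurable_translate c).

Definition negate : measurableTypeR R -> measurableTypeR R := -%R.

Lemma measurable_negate : measurable_fun setT negate.
Proof. exact: oppr_measurable. Qed.

HB.instance Definition _ := isMeasurableFun.Build _ _ _ _
  negate measurable_negate.

Lemma lebesgue_measure_translate (c : R) (A : set (measurableTypeR R)) :
  measurable A -> pushforward mu (translate c) A = mu A.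
Proof.
move=> mA; apply/esym/lebesgue_measure_unique => //= _ [[a b]] _ <-.
rewrite /pushforward/=.
have -> : translate c @^-1` `]a, b] = `]a - c, b - c]%classic :> set R.
  by apply/seteqP; split => x; rewrite /translate /= !in_itv/= ltrBlDr lerBrDr.
rewrite !lebesgue_measure_itv/= !lte_fin ltrD2r.
by case: ifP => // _; congr EFin; lra.
Qed.

Lemma normal_prob_translate (m : R) (A : set (measurableTypeR R)) :
  measurable A -> normal m A = pushforward (normal 0) (translate m) A.
Proof.
apply: normal_prob_pushforward; first exact: lebesgue_measure_translate.
move=> x; rewrite !normal_pdfE ?oner_neq0// /=.
by rewrite /normal_fun /translate addrK subr0.
Qed.

Lemma normal_prob_opp (A : set (measurableTypeR R)) :
  measurable A -> normal 0 A = pushforward (normal 0) negate A.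
Proof.
apply: normal_prob_pushforward; first exact: lebesgue_measureN.
move=> x; rewrite !normal_pdfE ?oner_neq0//= /normal_fun.
by rewrite !subr0 sqrrN.
Qed.

(** Only finiteness matters, so x^2 exp(-x^2/2) is compared with 4 exp(-x^2/4), a multiple of the
    density of variance 2, whose integral is known. *)
Lemma normal_second_moment :
  exists2 A : R, 0 < A & (\int[normal 0]_x (x ^+ 2)%:E <= A%:E)%E.
Proof.
pose s : R := Num.sqrt 2.
have s0 : s != 0 by rewrite gt_eqF// sqrtr_gt0.
exists (4 * (normal_peak 1 / normal_peak s)).
  by rewrite mulr_gt0// divr_gt0// normal_peak_gt0 // oner_neq0.
rewrite ge0_integral_normal_prob; last 2 first.
- by move=> x; rewrite lee_fin sqr_ge0.
- by apply/measurable_EFinP; exact: measurable_funX.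
rewrite -[leRHS]mule1 -(integral_normal_pdf 0 s).
have mp (m t : R) : measurable_fun setT (EFin \o normal_pdf m t).
  by apply/measurable_EFinP; exact: measurable_normal_pdf.
rewrite -ge0_integralZl//; last 3 first.
- exact: mp.
- by move=> x _; rewrite lee_fin normal_pdf_ge0.
- by rewrite lee_fin mulr_ge0// divr_ge0// normal_peak_ge0.
apply: ge0_le_integral => //.
- by move=> x _; rewrite mule_ge0// lee_fin ?sqr_ge0 ?normal_pdf_ge0.
- by apply: emeasurable_funM; [apply/measurable_EFinP; exact: measurable_funX|exact: mp].
- by apply: emeasurable_funM => //; exact: mp.
move=> x _; rewrite -!EFinM lee_fin !normal_pdfE ?oner_neq0//=.
have -> : 4 * (normal_peak 1 / normal_peak s) * (normal_peak s * normal_fun 0 s x)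
    = normal_peak 1 * (4 * normal_fun 0 s x).
  by field; rewrite gt_eqF// normal_peak_gt0.
rewrite mulrCA; apply: ler_wpM2l; first exact: normal_peak_ge0.
rewrite /normal_fun !subr0 expr1n sqr_sqrtr//.
(* In terms of [y] the comparison reads y exp(-y) <= 1, which follows from 1 + y <= exp y. *)
set y := x ^+ 2 / 4.
have -> : - x ^+ 2 / (1 *+ 2) = - y + - y by rewrite /y; field.
have -> : - x ^+ 2 / (2 *+ 2) = - y by rewrite /y; field.
have -> : x ^+ 2 = 4 * y by rewrite /y; field.
rewrite expRD -mulrA ler_pM2l// mulrA ler_piMl ?expR_ge0//.
rewrite expRN ler_pdivrMr ?expR_gt0// mul1r.
by apply: le_trans (expR_ge1Dx y); rewrite lerDr.
Qed.
End normal_law.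

(** * Elementary bounds on sine and cosine *)

Section trigonometry.
Context {R : realType}.
Implicit Types a b x : R.

(** The interval is symmetric so that [c] serves two purposes: [|cos c| <= 1] gives the Lipschitz
    bound, and [|c| <= 1] gives a lower bound on [cos c]. *)
Lemma sin_sub_mvt a b r : `|a| <= r -> `|b| <= r ->
  exists2 c, `|c| <= r & sin b - sin a = cos c * (b - a).
Proof.
wlog ab : a b / a <= b.
  move=> H ar br; have [ab|/ltW ba] := leP a b; first exact: H.
  have [c cr ec] := H _ _ ba br ar; exists c => //.
  by rewrite -opprB ec -mulrN opprB.
rewrite !ler_norml => /andP[ar _] /andP[_ br].
have [|c] := @MVT_segment _ sin cos a b ab.
  by apply: continuous_subspaceT => x; exact: continuous_sin.
rewrite in_itv/= => /andP[ac cb] ec; exists c => //.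
by rewrite ler_norml (le_trans ar ac) (le_trans cb br).
Qed.

Lemma ler_norm_sin x : `|sin x| <= `|x|.
Proof.
have [||c _] := @sin_sub_mvt 0 x `|x|; rewrite ?normr0// sin0 !subr0 => ->.
by rewrite normrM ler_piMl// cos_max.
Qed.

Lemma cos_ge x : 1 - x ^+ 2 / 2 <= cos x.
Proof.
have -> : x = (x / 2) *+ 2 by rewrite -mulr_natr divfK.
rewrite cos_mulr2n cos2sin2.
have : sin (x / 2) ^+ 2 <= (x / 2) ^+ 2.
  rewrite -[X in X <= _]real_normK ?num_real// -[X in _ <= X]real_normK ?num_real//.
  by rewrite ler_sqr ?nnegrE// ler_norm_sin.
rewrite -[_ *+ 2]mulr_natr; lra.
Qed.

(** On [-1, 1] the cosine is at least 1/2. This is what allows the argument of a sine to be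
    recovered from its value with controlled error. *)
Lemma sin_expanding a b : `|a| <= 1 -> `|b| <= 1 ->
  `|a - b| <= 2 * `|sin a - sin b|.
Proof.
move=> a1 b1; have [c c1 ->] := sin_sub_mvt b1 a1.
rewrite normrM mulrA ler_peMl//.
have c21 : c ^+ 2 <= 1 by rewrite -real_normK ?num_real// expr_le1.
have := cos_ge c; have := ler_norm (cos c); lra.
Qed.
End trigonometry.

Lemma bounded_integrable d (T : measurableType d) (R : realType)
    (P : probability T R) (f : T -> R) (M : R) :
  measurable_fun setT f -> (forall x, `|f x| <= M) ->
  P.-integrable setT (EFin \o f).
Proof.
move=> mf fM; apply: measurable_bounded_integrable => //.
  by rewrite (le_lt_trans (probability_le1 P measurableT))// ltry.
exists M; split; first exact: num_real.
by move=> y My x _ /=; rewrite (le_trans (fM x))// ltW.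
Qed.

(** * Expectations of the identity, sine and cosine under a normal law *)

Section normal_expectations.
Context {R : realType}.
Local Notation normal m := (normal_prob m 1 : probability (measurableTypeR R) R).
Implicit Types (m w b : R) (f : measurableTypeR R -> R).

Lemma integral_normal_translate m f : measurable_fun setT f ->
  (normal 0).-integrable setT (EFin \o f \o translate m) ->
  (\int[normal m]_x (f x)%:E = \int[normal 0]_x (f (x + m))%:E)%E.
Proof.
move=> mf intf; rewrite (eq_measure_integral (pushforward (normal 0) (translate m))).
  rewrite (integral_pushforward (measurable_translate m) _ intf)//.
  exact/measurable_EFinP.
by move=> A mA _; exact: normal_prob_translate.
Qed.

(** Reflection turns the integral into its opposite; finiteness then forces it to vanish. *)
Lemma integral_normal_odd f : measurable_fun setT f ->
  (normal 0).-integrable setT (EFin \o f) -> (forall x, f (- x) = - f x) ->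
  (\int[normal 0]_x (f x)%:E = 0)%E.
Proof.
move=> mf intf oddf.
have intfN : (normal 0).-integrable setT (EFin \o f \o negate).
  rewrite (_ : _ \o _ = (fun x => - (EFin \o f) x)%E); first exact: integrableN.
  by apply/funext => x; rewrite /negate /= oddf EFinN.
have : (\int[normal 0]_x (f x)%:E = - \int[normal 0]_x (f x)%:E)%E.
  rewrite [LHS](eq_measure_integral (pushforward (normal 0) negate)); last first.
    by move=> A mA _; exact: normal_prob_opp.
  rewrite (integral_pushforward measurable_negate _ intfN)//; last first.
    exact/measurable_EFinP.
  rewrite -integralN; last exact: integrable_add_def.
  by apply: eq_integral => x _; rewrite /negate /= oddf EFinN.
have /fineK <- := integrable_fin_num measurableT intf.
rewrite -EFinN => -[] h; congr EFin; lra.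
Qed.

Lemma integrable_normal_id0 : (normal 0).-integrable setT (fun x => x%:E).
Proof.
have [A _ leA] := @normal_second_moment R.
apply: (@le_integrable _ (measurableTypeR R) R (normal 0) setT measurableT _
  (fun x => (1 + x ^+ 2)%:E)).
- exact/measurable_EFinP.
- move=> x _; rewrite /= lee_fin [leRHS]ger0_norm ?addr_ge0 ?sqr_ge0//.
  rewrite -[x ^+ 2]real_normK ?num_real//; have := sqr_ge0 (`|x| - 1).
  rewrite sqrrB; have := normr_ge0 x; lra.
apply/integrableP; split.
  by apply/measurable_EFinP/measurable_funD => //; exact: measurable_funX.
under eq_integral do rewrite /= ger0_norm ?addr_ge0 ?sqr_ge0// EFinD.
rewrite ge0_integralD//; last 2 first.
- by move=> x _; rewrite lee_fin sqr_ge0.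
- by apply/measurable_EFinP; exact: measurable_funX.
rewrite integral_cst// mul1e; apply: lte_add_pinfty.
  by rewrite (le_lt_trans (probability_le1 _ measurableT))// ltry.
by rewrite (le_lt_trans leA)// ltry.
Qed.

Lemma integrable_normal_translate_id m :
  (normal 0).-integrable setT (EFin \o (@id R) \o translate m).
Proof.
rewrite (_ : _ \o _ = (fun x : R => x%:E + m%:E)%E)//.
apply: integrableD => //; first exact: integrable_normal_id0.
exact: finite_measure_integrable_cst.
Qed.

Lemma integrable_normal_id m : (normal m).-integrable setT (fun x => x%:E).
Proof.
apply/integrableP; split; first exact/measurable_EFinP.
rewrite (eq_measure_integral (pushforward (normal 0) (translate m))).
  have mid : measurable_fun [set: measurableTypeR R] (EFin \o @id R).
    exact/measurable_EFinP.
  by have /integrableP[] := integrable_pushforward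
    (@measurable_translate R m) mid (integrable_normal_translate_id m) measurableT.
by move=> A mA _; exact: normal_prob_translate.
Qed.

Lemma integral_normal_id m : (\int[normal m]_x x%:E = m%:E)%E.
Proof.
rewrite integral_normal_translate//; last exact: integrable_normal_translate_id.
under eq_integral do rewrite EFinD.
rewrite integralD//; last 2 first.
- exact: integrable_normal_id0.
- exact: finite_measure_integrable_cst.
rewrite integral_normal_odd//; last exact: integrable_normal_id0.
rewrite integral_cst//=.
by rewrite [normal_prob _ _ _](@probability_setT _ _ _ (normal 0)) mule1 add0e.
Qed.

(* The closed form exp (- w^2 / 2) is never needed, only the bounds below. *)
Definition normal_cos w : R := fine (\int[normal 0]_x (cos (w * x))%:E).

Lemma measurable_sin_affine w b :
  measurable_fun setT ((fun x => sin (w * x + b)) : measurableTypeR R -> _).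
Proof.
apply: (measurableT_comp (f := sin : R -> R)).
  by apply: continuous_measurable_fun; exact: continuous_sin.
by apply: measurable_funD => //; exact: measurable_funM.
Qed.

Lemma integrable_sin_affine (P : probability (measurableTypeR R) R) w b :
  P.-integrable setT (fun x => (sin (w * x + b))%:E).
Proof.
apply: (@bounded_integrable _ _ _ P _ 1); first exact: measurable_sin_affine.
by move=> x; exact: sin_max.
Qed.

Lemma integrable_cos w : (normal 0).-integrable setT (fun x => (cos (w * x))%:E).
Proof.
have := integrable_sin_affine (normal 0) w (pi / 2).
by apply: eq_integrable => // x _; rewrite sinDpihalf.
Qed.

Lemma integral_normal_cos w :
  (\int[normal 0]_x (cos (w * x))%:E = (normal_cos w)%:E)%E.
Proof. by rewrite fineK// integrable_fin_num//; exact: integrable_cos. Qed.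

(** After centring, the addition formula splits off an odd part, whose integral vanishes, and leaves
    a damping factor. The free phase [b] carries the contribution of the other coordinates in the
    induction for product laws. *)
Lemma integral_normal_sin m w b :
  (\int[normal m]_x (sin (w * x + b))%:E
   = (normal_cos w * sin (w * m + b))%:E)%E.
Proof.
rewrite (@integral_normal_translate _ (fun x => sin (w * x + b))); last 2 first.
- exact: measurable_sin_affine.
- have := integrable_sin_affine (normal 0) w (w * m + b).
  by apply: eq_integrable => // x _ /=; rewrite /translate mulrDr addrA.
have sin0w := integrable_sin_affine (normal 0) w 0.
under eq_integral => x _.
  rewrite mulrDr -addrA addrC sinD EFinD !EFinM; over.
rewrite integralD//; last 2 first.
- by apply: integrableZl => //; exact: integrable_cos.
- apply: integrableZl => //; move: sin0w.
  by apply: eq_integrable => // x _; rewrite addr0.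
rewrite !integralZl//; last 2 first.
- by move: sin0w; apply: eq_integrable => // x _; rewrite addr0.
- exact: integrable_cos.
rewrite integral_normal_cos (@integral_normal_odd (fun x => sin (w * x))).
- by rewrite mule0 adde0 -EFinM mulrC.
- have := measurable_sin_affine w 0; by under eq_fun do rewrite addr0.
- by move: sin0w; apply: eq_integrable => // x _; rewrite addr0.
- by move=> x; rewrite mulrN sinN.
Qed.

Lemma normal_cos_le1 w : normal_cos w <= 1.
Proof.
rewrite -lee_fin -integral_normal_cos.
apply: (@le_trans _ _ (\int[normal 0]_x (cst 1%:E) x))%E; last first.
  by rewrite integral_cst//= mul1e probability_le1.
apply: le_integral => //; first exact: integrable_cos.
  exact: finite_measure_integrable_cst.
by move=> x _; rewrite lee_fin cos_le1.
Qed.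

(** Integrate cos(w x) >= 1 - (w x)^2 / 2; [A] is the bound on the second moment. *)
Lemma normal_cos_ge :
  exists2 A : R, 0 < A & forall w, 1 - A * w ^+ 2 / 2 <= normal_cos w.
Proof.
have [A A0 leA] := @normal_second_moment R; exists A => // w.
have intx2 : (normal 0).-integrable setT (fun x => (x ^+ 2)%:E).
  apply/integrableP; split; first by apply/measurable_EFinP/measurable_funX.
  under eq_integral do rewrite /= ger0_norm ?sqr_ge0//.
  by rewrite (le_lt_trans leA)// ltry.
have : (1%:E <= \int[normal 0]_x
    ((cos (w * x))%:E + (w ^+ 2 / 2)%:E * (x ^+ 2)%:E))%E.
  apply: (@le_trans _ _ (\int[normal 0]_x (cst 1%:E) x))%E.
    by rewrite integral_cst//= mul1e probability_setT.
  apply: le_integral => //.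
  - exact: finite_measure_integrable_cst.
  - by apply: integrableD => //; [exact: integrable_cos|exact: integrableZl].
  move=> x _; rewrite -EFinM -EFinD lee_fin; have := cos_ge (w * x).
  rewrite exprMn; lra.
rewrite integralD//; last 2 first.
- exact: integrable_cos.
- exact: integrableZl.
rewrite integralZl// integral_normal_cos.
move: leA; have /fineK <- := integrable_fin_num measurableT intx2.
rewrite -EFinM -EFinD !lee_fin; set a := fine _ => aA.
have : w ^+ 2 * a <= w ^+ 2 * A by rewrite ler_wpM2l// sqr_ge0.
lra.
Qed.
End normal_expectations.

(** * Expectations under products of normal laws *)

Section product_expectations.
Context {R : realType}.
Local Notation normal m := (normal_prob m 1 : probability (measurableTypeR R) R).

Lemma integral_product_prob_cons d (T : measurableType d) n
    (P : 'I_n.+1 -> probability T R) (f : n.+1.-tuple T -> R) (M : R) :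
  measurable_fun setT f -> (forall t, `|f t| <= M) ->
  (\int[product_prob P]_t (f t)%:E =
   \int[P ord0]_x \int[product_prob (fun i => P (lift ord0 i))]_t
     (f (tuple_cons (x, t)))%:E)%E.
Proof.
move=> mf fM; set Q := product_prob (fun i => P (lift ord0 i)).
have mfc : measurable_fun setT (f \o @tuple_cons _ T n).
  by apply: measurableT_comp => //; exact: measurable_tuple_cons.
have intf := @bounded_integrable _ _ _ (P ord0 \x Q)%E _ M mfc (fun z => fM _).
rewrite /= integral_distribution//=; last exact/measurable_EFinP.
by rewrite -(integral12_prod_meas1 intf).
Qed.

Lemma measurable_sin_linear n (w : 'I_n -> R) b :
  measurable_fun setT (fun t : n.-tuple (measurableTypeR R) =>
    sin (\sum_i w i * tnth t i + b)).
Proof.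
apply: (measurableT_comp (f := sin : R -> R)).
  by apply: continuous_measurable_fun; exact: continuous_sin.
apply: measurable_funD => //; apply: measurable_sum => i.
by apply: measurable_funM => //; exact: measurable_tnth.
Qed.

(** Integrating out one coordinate keeps the integrand a sine: each coordinate is replaced by its
    mean at the price of one damping factor. *)
Lemma integral_sin_linear n (m w : 'I_n -> R) b :
  (\int[product_prob (fun i => normal (m i))]_t
     (sin (\sum_i w i * tnth t i + b))%:E
   = ((\prod_i normal_cos (w i)) * sin (\sum_i w i * m i + b))%:E)%E.
Proof.
elim: n m w b => [|n IH] m w b.
  rewrite /= integral_dirac//; last first.
    by apply/measurable_EFinP; exact: measurable_sin_linear.
  by rewrite diracT mul1e !big_ord0 mul1r.
rewrite (@integral_product_prob_cons _ _ _ _ _ 1); last 2 first.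
- exact: measurable_sin_linear.
- by move=> t; exact: sin_max.
pose c := \prod_(i < n) normal_cos (w (lift ord0 i)).
pose s := \sum_(i < n) w (lift ord0 i) * m (lift ord0 i) + b.
transitivity (\int[normal (m ord0)]_x
    (c%:E * (sin (w ord0 * x + s))%:E))%E.
  apply: eq_integral => x _.
  have -> : w ord0 * x + s = \sum_(i < n) w (lift ord0 i) * m (lift ord0 i)
      + (w ord0 * x + b) by rewrite /s addrCA.
  rewrite -EFinM -(IH (m \o lift ord0) (w \o lift ord0)).
  apply: eq_integral => t _; rewrite big_ord_recl /= addrAC addrC addrA.
  by under eq_bigr do rewrite tnthS; rewrite -addrA.
rewrite integralZl//; last exact: integrable_sin_affine.
rewrite integral_normal_sin -EFinM !big_ord_recl -/c -[in RHS]addrA -/s.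
by congr EFin; rewrite mulrA [c * _]mulrC.
Qed.

(** The integrand is unbounded, so the proof goes through the marginal law: [product_probE] with
    full sets at the other coordinates shows that the [i]-th one has law [normal (m i)]. *)
Lemma integral_product_prob_tnth n (m : 'I_n -> R) i :
  (\int[product_prob (fun i => normal (m i))]_t (tnth t i)%:E = (m i)%:E)%E.
Proof.
set P := product_prob _.
have mi : measurable_fun setT (fun t : n.-tuple (measurableTypeR R) => tnth t i).
  exact: measurable_tnth.
have Pi A : measurable A ->
    normal (m i) A = pushforward P (fun t : n.-tuple (measurableTypeR R) => tnth t i) A.
  move=> mA; pose B j := if j == i then A else setT.
  transitivity (P [set t | forall j, B j (tnth t j)]).
    rewrite product_probE.
      rewrite (bigD1 i)//= big1 ?mule1 /B ?eqxx// => j /negbTE ->.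
      exact: probability_setT.
    by move=> j; rewrite /B; case: ifP.
  rewrite /pushforward; congr (P _); apply/seteqP; split => t /=.
    by move=> /(_ i); rewrite /B eqxx.
  by move=> At j; rewrite /B; case: eqP => // ->.
have intP : P.-integrable setT (fun t => (tnth t i)%:E).
  apply/integrableP; split; first exact/measurable_EFinP.
  have /integrableP[_] := integrable_normal_id (m i).
  rewrite (eq_measure_integral (pushforward P
    (fun t : n.-tuple (measurableTypeR R) => tnth t i))); last first.
    by move=> A mA _; exact: Pi.
  rewrite ge0_integral_pushforward//.
  by apply: measurableT_comp => //; exact/measurable_EFinP.
rewrite -(integral_normal_id (m i)).
rewrite [RHS](eq_measure_integral (pushforward P
  (fun t : n.-tuple (measurableTypeR R) => tnth t i))).
  by rewrite (integral_pushforward mi _ intP)//; exact/measurable_EFinP.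
by move=> A mA _; exact: Pi.
Qed.
End product_expectations.

(** * Queries and oracles *)

Section tensor_queries.
Context {R : realType} {k d : nat}.
Local Notation J := {ffun 'I_k -> 'I_d}.
Local Notation normal m := (normal_prob m 1 : probability (measurableTypeR R) R).
Implicit Types (m W : J -> R) (T : tensor R k d).

Definition normal_tensor m : probability (tensor R k d) R :=
  product_prob (fun i => normal (m (enum_val i))).

Lemma gaussian_tensorE (V : tensor R k d) :
  gaussian_tensor V = normal_tensor (fun j => entry V j / d%:R `^ (k%:R / 2)).
Proof.
rewrite /gaussian_tensor /normal_tensor; congr product_prob.
by apply/funext => i; rewrite /entry enum_valK.
Qed.

Lemma mean_normal_tensor m j : entry (mean_tensor (normal_tensor m)) j = m j.
Proof.
rewrite tensor_ofE unlock.
by rewrite integral_product_prob_tnth/= enum_rankK.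
Qed.

Definition contract W T : R := \sum_j W j * entry T j.

Lemma contractE W T : contract W T = \sum_i W (enum_val i) * tnth T i.
Proof.
rewrite /contract (reindex (fun i : 'I_#|{: J}| => enum_val i)) /=; last first.
  exact/onW_bij/enum_val_bij.
by apply: eq_bigr => i _; rewrite /entry enum_valK.
Qed.

Definition sin_query_fun W : tensor R k d -> measurableTypeR R :=
  fun T => (1 + sin (contract W T)) / 2.

Lemma measurable_sin_query W : measurable_fun setT (sin_query_fun W).
Proof.
rewrite (_ : sin_query_fun W = fun T : tensor R k d =>
    (1 + sin (\sum_i W (enum_val i) * tnth T i + 0)) / 2); last first.
  by apply/funext => T; rewrite /sin_query_fun contractE addr0.
apply: measurable_funM => //; apply: measurable_funD => //.
exact: measurable_sin_linear.
Qed.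

HB.instance Definition _ W := isMeasurableFun.Build _ _ _ _
  (sin_query_fun W) (measurable_sin_query W).

Lemma sin_query_itv W T : 0 <= sin_query_fun W T <= 1.
Proof.
rewrite /sin_query_fun.
have := sin_max (contract W T); rewrite ler_norml => /andP[s1 s2].
by apply/andP; split; lra.
Qed.

Definition sin_query W : query R k d :=
  @Query R k d (sin_query_fun W) (sin_query_itv W).

Lemma mean_sin_query m W : mean (normal_tensor m) (sin_query W) =
  (1 + (\prod_j normal_cos (W j)) * sin (\sum_j W j * m j)) / 2.
Proof.
rewrite /mean unlock /=.
have -> : \prod_j normal_cos (W j) = \prod_(i < #|{: J}|) normal_cos (W (enum_val i)).
  rewrite (reindex (fun i : 'I_#|{: J}| => enum_val i))//=; exact/onW_bij/enum_val_bij.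
have -> : \sum_j W j * m j = \sum_(i < #|{: J}|) W (enum_val i) * m (enum_val i).
  rewrite (reindex (fun i : 'I_#|{: J}| => enum_val i))//=; exact/onW_bij/enum_val_bij.
have intsin : (normal_tensor m).-integrable setT
    (fun T => (sin (\sum_i W (enum_val i) * tnth T i + 0))%:E).
  apply: (@bounded_integrable _ _ _ _ _ 1); first exact: measurable_sin_linear.
  by move=> T; exact: sin_max.
have int1 : (normal_tensor m).-integrable setT (fun=> 1%:E).
  exact: finite_measure_integrable_cst.
transitivity (fine (\int[normal_tensor m]_T (2^-1%:E *
    (1%:E + (sin (\sum_i W (enum_val i) * tnth T i + 0))%:E)))).
  congr fine; apply: eq_integral => T _.
  by rewrite -EFinD -EFinM /sin_query_fun contractE addr0 mulrC.
rewrite integralZl//; last exact: integrableD.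
have -> : (\int[normal_tensor m]_T
    (1%:E + (sin (\sum_i W (enum_val i) * tnth T i + 0))%:E) =
    1%:E + ((\prod_(i < #|{: J}|) normal_cos (W (enum_val i))) *
      sin (\sum_(i < #|{: J}|) W (enum_val i) * m (enum_val i) + 0))%:E)%E.
  rewrite integralD//; congr (_ + _)%E; last exact: integral_sin_linear.
  by rewrite integral_cst// mul1e; exact: probability_setT.
by rewrite -EFinD -EFinM /= addr0 mulrC.
Qed.
End tensor_queries.

(** * Accuracy of one answer, and batches of queries *)

Section sq_algorithms.
Context {R : realType} {k d : nat}.

(** Bounds both terms of the VSTAT error: 1/n <= 1/sqrt n for n >= 1, and p (1 - p) <= 1. *)
Definition tolerance (n : nat) : R := Num.sqrt n%:R^-1.

Definition consistent (D : probability (tensor R k d) R) (n : nat) (I : Type)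
    (Q : I -> query R k d) (a : I -> R) (i : I) : Prop :=
  `|a i - mean D (Q i)| <= tolerance n.

Lemma mean_itv (D : probability (tensor R k d) R) (q : query R k d) :
  0 <= mean D q <= 1.
Proof.
have intq : D.-integrable setT (EFin \o q).
  apply: (@bounded_integrable _ _ _ _ _ 1); first exact: (measurable_funPT q).
  by move=> T; have /andP[q0 q1] := query_itv q T; rewrite ger0_norm.
have fq := integrable_fin_num measurableT intq.
rewrite /mean unlock -!lee_fin fineK//; apply/andP; split.
  by apply: integral_ge0 => T _; rewrite lee_fin; have /andP[] := query_itv q T.
apply: (@le_trans _ _ (\int[D]_T (cst 1%:E) T))%E; last first.
  by rewrite integral_cst//= mul1e probability_le1.
apply: le_integral => //; first exact: finite_measure_integrable_cst.
by move=> T _; rewrite lee_fin; have /andP[] := query_itv q T.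
Qed.

Lemma vstat_tolerance (D : probability (tensor R k d) R) n O h q : (0 < n)%N ->
  vstat D n O -> `|O h q - mean D q| <= tolerance n.
Proof.
move=> n0 /(_ h q) /le_trans; apply.
rewrite ge_max; apply/andP; split.
  rewrite -[n%:R^-1]ger0_norm ?invr_ge0// -sqrtr_sqr ler_wsqrtr// expr2.
  by rewrite ler_piMl ?invr_ge0// invf_le1 ?ltr0n// ler1n.
rewrite ler_wsqrtr// ler_piMl ?invr_ge0//.
have /andP[m0 m1] := mean_itv D q.
by rewrite mulr_ile1// ?subr_ge0// lerBlDr lerDl.
Qed.

(** A batch whose queries are fixed in advance. The table [a] starts from arbitrary values, collects
    the answers, and is handed to [next] at the end; adaptivity comes from nesting batches. *)
Fixpoint ask (Out : Type) (I : eqType) (Q : I -> query R k d) (s : seq I)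
    (next : (I -> R) -> sq_algorithm R k d Out) (a : I -> R) :
    sq_algorithm R k d Out :=
  if s is i :: s' then
    Ask (Q i) (fun r => ask Q s' next (fun j => if j == i then r else a j))
  else next a.

(** The invariant lets an index be either still pending or already answered well; a repeated query
    only overwrites one good answer by another. *)
Lemma run_ask (Out : Type) (I : eqType) (Q : I -> query R k d) (s : seq I)
    (next : (I -> R) -> sq_algorithm R k d Out) (a : I -> R) D n O h :
  (0 < n)%N -> vstat D n O -> exists h' a',
  [/\ run_from O h (ask Q s next a) = run_from O h' (next a'),
      size h' = (size h + size s)%N &
      forall i, i \in s \/ consistent D n Q a i -> consistent D n Q a' i].
Proof.
move=> n0 vO; elim: s a h => [|i s IH] a h /=.
  exists h, a; split => //; first by rewrite addn0.
  by move=> i [].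
have [h' [a' [-> sz good]]] := IH (fun j => if j == i then O h (Q i) else a j)
  (rcons h (Q i, O h (Q i))).
exists h', a'; split => //; first by rewrite sz size_rcons addSnnS.
move=> j; rewrite in_cons => ij; apply: good.
have [->|ji] := eqVneq j i.
  by right; rewrite /consistent eqxx; exact: vstat_tolerance.
case: ij => [/orP[/eqP e|js]|cj]; [by rewrite e eqxx in ji|by left|].
by right; rewrite /consistent (negbTE ji).
Qed.
End sq_algorithms.

(** The Weierstrass product inequality, by induction on the list. *)
Lemma prod_ge_one_sub_sum (R : realDomainType) (J : Type) (r : seq J) (p : J -> R) :
  (forall j, 0 <= p j <= 1) -> 1 - \sum_(j <- r) (1 - p j) <= \prod_(j <- r) p j.
Proof.
move=> p01; elim: r => [|j r IH]; first by rewrite !big_nil subr0.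
have /andP[p0 p1] := p01 j.
have q1 : \prod_(i <- r) p i <= 1.
  by rewrite Num.Theory.prodr_ile1// => i _; exact: p01.
rewrite !big_cons; nra.
Qed.

Definition l2 (R : realType) (J : finType) (W : J -> R) : R :=
  Num.sqrt (\sum_j W j ^+ 2).

(** * Resolving a linear functional of the mean with one query *)

Section resolution.
Context {R : realType}.

Lemma sum_sqr_ge0 (J : finType) (W : J -> R) : 0 <= \sum_j W j ^+ 2.
Proof. by apply: sumr_ge0 => j _; exact: sqr_ge0. Qed.

Lemma sum_mul_le1 (J : finType) (W m : J -> R) :
  \sum_j W j ^+ 2 <= 1 -> \sum_j m j ^+ 2 <= 1 -> `|\sum_j W j * m j| <= 1.
Proof.
move=> W1 m1; apply: le_trans (ler_norm_sum _ _ _) _.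
apply: (@le_trans _ _ (\sum_j (W j ^+ 2 + m j ^+ 2) / 2)).
  apply: ler_sum => j _; rewrite ler_norml; apply/andP; split.
    have := sqr_ge0 (W j + m j); nra.
  have := sqr_ge0 (W j - m j); nra.
by rewrite -mulr_suml big_split/=; lra.
Qed.

(** Each factor is at least 1 - A w_j^2 / 2, so the Weierstrass inequality bounds the product
    through the squared norm of [w] alone, whatever the number of entries. *)
Lemma prod_normal_cos_ge : exists2 s : R, 0 < s <= 1 &
  forall (J : finType) (w : J -> R), \sum_j w j ^+ 2 <= s ^+ 2 ->
  2^-1 <= \prod_j normal_cos (w j).
Proof.
have [A A0 cosA] := @normal_cos_ge R.
have A1 : 0 < 1 + A by rewrite addr_gt0.
have s01 : 0 < (1 + A)^-1 <= 1 by rewrite invr_gt0 A1 invf_le1// lerDl ltW.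
(* This value ensures both s <= 1 and A s^2 <= 1. *)
exists (1 + A)^-1 => // J w ws.
have As : A * (1 + A)^-1 ^+ 2 <= 1.
  rewrite exprVn ler_pdivrMr ?exprn_gt0// mul1r; nra.
have wj j : A * w j ^+ 2 <= 1.
  apply: le_trans As; rewrite ler_pM2l//; apply: le_trans ws.
  by rewrite (bigD1 j)//= lerDl sumr_ge0// => i _; exact: sqr_ge0.
apply: (le_trans _ (@prod_ge_one_sub_sum _ _ (index_enum J) _ _)); last first.
  by move=> j; rewrite normal_cos_le1 (le_trans _ (cosA _))//; have := wj j; lra.
apply: (@le_trans _ _ (1 - \sum_j A * w j ^+ 2 / 2)).
  by rewrite -mulr_suml -mulr_sumr; nra.
by rewrite lerD2l lerN2; apply: ler_sum => j _; have := cosA (w j); lra.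
Qed.

(* C depends neither on k and d nor on the functional W. *)
Lemma exists_query : exists2 C : R, 0 < C &
  forall (k d : nat) (W : {ffun 'I_k -> 'I_d} -> R), exists q : query R k d,
  forall m m', \sum_j m j ^+ 2 <= 1 -> \sum_j m' j ^+ 2 <= 1 ->
  `|\sum_j W j * m j - \sum_j W j * m' j|
    <= C * l2 W * `|mean (normal_tensor m) q - mean (normal_tensor m') q|.
Proof.
have [s /andP[s0 s1] cos_ge] := prod_normal_cos_ge.
(* The 8 is a product of three factors 2: inverting the sine, the halving in the query, and the
   damping factor being at least 1/2. *)
exists (8 / s); first by rewrite divr_gt0.
(* [w] is [W] rescaled to norm [s]: small enough for the damping bound and for the argument of the
   sine to stay in [-1, 1]. *)
move=> k d W; pose t := l2 W; pose w j := s / t * W j.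
have t2 : t ^+ 2 = \sum_j W j ^+ 2 by rewrite sqr_sqrtr// sum_sqr_ge0.
have wW m : \sum_j w j * m j = s / t * \sum_j W j * m j.
  by rewrite mulr_sumr; apply: eq_bigr => j _; rewrite mulrA.
exists (sin_query w) => m m' m1 m'1.
(* For t = 0 the rescaling is degenerate, but then [W] vanishes and both contractions are 0. *)
have [t0|t_neq0] := eqVneq t 0.
  have W0 j : W j = 0.
    move/eqP: t2; rewrite t0 expr0n/= eq_sym psumr_eq0; last by move=> i _; exact: sqr_ge0.
    by move=> /allP/(_ j (mem_index_enum _)); rewrite sqrf_eq0 => /eqP.
  by rewrite -/t t0 mulr0 mul0r !big1 ?subrr ?normr0// => j _; rewrite W0 mul0r.
have t_gt0 : 0 < t by rewrite lt0r t_neq0 sqrtr_ge0.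
have ws : \sum_j w j ^+ 2 = s ^+ 2.
  under eq_bigr do rewrite exprMn.
  by rewrite -mulr_sumr -t2 -exprMn divfK.
have w1 : \sum_j w j ^+ 2 <= 1 by rewrite ws expr_le1// ltW.
rewrite !mean_sin_query; set c := \prod_j _.
have c2 : 2^-1 <= c by apply: cos_ge; rewrite ws.
have := sin_expanding (sum_mul_le1 w1 m1) (sum_mul_le1 w1 m'1).
set x := sin _; set y := sin _.
rewrite !wW -mulrBr normrM gtr0_norm ?divr_gt0//.
rewrite -ler_pdivlMl ?divr_gt0// invf_div.
set D := `|_ - \sum_j _| => hD.
have -> : (1 + c * x) / 2 - (1 + c * y) / 2 = c / 2 * (x - y) by ring.
rewrite normrM gtr0_norm; last by lra.
apply: (le_trans hD); rewrite -/t.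
have -> : 8 / s * t * (c / 2 * `|x - y|) = t / s * (4 * c * `|x - y|).
  by field; rewrite gt_eqF.
apply: ler_wpM2l; first by rewrite divr_ge0 ?ltW.
  by apply: ler_wpM2r => //; lra.
Qed.
End resolution.

(** * Partial traces of rank-one tensors *)

Definition mult k (L : eqType) (lab : 'I_k -> L) (i : L) : nat :=
  \sum_a (lab a == i).

Definition tail_labels k (L : Type) (lab : 'I_k.+1 -> L) : 'I_k -> L :=
  lab \o lift ord0.

Lemma odd_mult_recl k (L : eqType) (lab : 'I_k.+1 -> L) i :
  odd (mult lab i) = (lab ord0 == i) (+) odd (mult (tail_labels lab) i).
Proof. by rewrite /mult big_ord_recl oddD oddb. Qed.

Section odd_classes.
Context {k : nat} {L : finType} (lab : 'I_k.+1 -> L).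
Context {T : Type} {idx : T} {op : Monoid.com_law idx} (F : L -> T).
Local Notation i0 := (lab ord0).

(** Dropping the first position flips the parity of its label and of no other, so the set of odd
    classes changes by exactly that label. The next lemma is the opposite parity. *)
Lemma big_odd_recl_even : ~~ odd (mult (tail_labels lab) i0) ->
  \big[op/idx]_(i | odd (mult lab i)) F i =
  op (F i0) (\big[op/idx]_(i | odd (mult (tail_labels lab) i)) F i).
Proof.
move=> ev; rewrite (bigD1 i0)/=; last by rewrite odd_mult_recl eqxx (negbTE ev).
congr (op _ _); apply: eq_bigl => i; rewrite odd_mult_recl.
have [->|_] := eqVneq i i0; first by rewrite andbF (negbTE ev).
by rewrite andbT.
Qed.

Lemma big_odd_recl_odd : odd (mult (tail_labels lab) i0) ->
  \big[op/idx]_(i | odd (mult (tail_labels lab) i)) F i =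
  op (F i0) (\big[op/idx]_(i | odd (mult lab i)) F i).
Proof.
move=> od; rewrite (bigD1 i0)//=.
congr (op _ _); apply: eq_bigl => i; rewrite odd_mult_recl.
have [->|_] := eqVneq i i0; first by rewrite andbF od.
by rewrite andbT.
Qed.
End odd_classes.

Section multi_indices.
Context {k d : nat}.

Definition index_cons (y : 'I_d) (j : {ffun 'I_k -> 'I_d}) :
  {ffun 'I_k.+1 -> 'I_d} :=
  [ffun a => if unlift ord0 a is Some b then j b else y].

Definition index_tail (j : {ffun 'I_k.+1 -> 'I_d}) : {ffun 'I_k -> 'I_d} :=
  [ffun a => j (lift ord0 a)].

Lemma index_cons0 y j : index_cons y j ord0 = y.
Proof. by rewrite ffunE unlift_none. Qed.

Lemma index_consS y j a : index_cons y j (lift ord0 a) = j a.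
Proof. by rewrite ffunE liftK. Qed.

Lemma index_consK y j : index_tail (index_cons y j) = j.
Proof. by apply/ffunP => a; rewrite ffunE index_consS. Qed.

Lemma sum_index_recl (R : nmodType) (F : {ffun 'I_k.+1 -> 'I_d} -> R) :
  \sum_j F j = \sum_y \sum_j F (index_cons y j).
Proof.
rewrite pair_big/= (reindex (fun p : 'I_d * {ffun 'I_k -> 'I_d} =>
  index_cons p.1 p.2))//=.
exists (fun j : {ffun 'I_k.+1 -> 'I_d} => (j ord0, index_tail j)) => [[y j] _|j _] /=.
  by rewrite index_cons0 index_consK.
apply/ffunP => a; case: (unliftP ord0 a) => [b ->|->].
  by rewrite index_consS ffunE.
by rewrite index_cons0.
Qed.
End multi_indices.

Section partial_trace.
Context {R : realType} {d : nat} {L : finType}.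

Definition basis_vec (y z : 'I_d) : R := (z == y)%:R.

Definition set_vec (x : L -> 'I_d -> R) (i : L) (v : 'I_d -> R) : L -> 'I_d -> R :=
  fun l => if l == i then v else x l.

(* The identity matrix on each pair of equally labelled positions, and x i on the
   position of class i left over when that class is odd.  A first position that
   has a partner is absorbed by feeding the partner the basis vector j ord0. *)
Fixpoint trace_tensor k : ('I_k -> L) -> (L -> 'I_d -> R) ->
    {ffun 'I_k -> 'I_d} -> R :=
  match k with
  | 0 => fun _ _ _ => 1
  | k'.+1 => fun lab x j =>
      if odd (mult (tail_labels lab) (lab ord0)) then
        trace_tensor (tail_labels lab) (set_vec x (lab ord0) (basis_vec (j ord0)))
          (index_tail j)
      else x (lab ord0) (j ord0) * trace_tensor (tail_labels lab) x (index_tail j)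
  end.

(** Follows the recursion of [trace_tensor] and counts the positions that are absorbed by a
    partner. *)
Fixpoint npairs k : ('I_k -> L) -> nat :=
  match k with
  | 0 => fun _ => 0%N
  | k'.+1 => fun lab =>
      (odd (mult (tail_labels lab) (lab ord0)) + npairs (tail_labels lab))%N
  end.

(** Each added position either opens an odd class or closes one; closing turns one odd class into
    one pair, a net gain of 2 - 1. *)
Lemma npairsE k (lab : 'I_k -> L) :
  ((npairs lab).*2 + \sum_(i | odd (mult lab i)) 1 = k)%N.
Proof.
elim: k lab => [|k IH] lab /=.
  by rewrite big_pred0// => i; rewrite /mult big_ord0.
rewrite -[in RHS](IH (tail_labels lab)).
have [od|od] := boolP (odd (mult (tail_labels lab) (lab ord0))).
  rewrite (big_odd_recl_odd (op := addn) (fun=> 1%N) od) /=; lia.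
rewrite (big_odd_recl_even (op := addn) (fun=> 1%N) od) /=; lia.
Qed.

Lemma sum_basis_vec (y : 'I_d) (F : 'I_d -> R) : \sum_z basis_vec y z * F z = F y.
Proof.
rewrite (bigD1 y)//= /basis_vec eqxx mul1r big1 ?addr0// => z /negbTE ->.
by rewrite mul0r.
Qed.

Lemma sum_index0 (F : {ffun 'I_0 -> 'I_d} -> R) c :
  (forall j, F j = c) -> \sum_j F j = c.
Proof.
move=> Fc; under eq_bigr do rewrite Fc.
by rewrite sumr_const card_ffun !card_ord expn0.
Qed.

(** An identity matrix on a pair contracts with u_i (x) u_i to |u_i|^2 = 1, so only the leftover
    position of each odd class contributes. *)
Lemma trace_tensor_spike k (lab : 'I_k -> L) (x u : L -> 'I_d -> R) :
  (forall i, \sum_y u i y ^+ 2 = 1) ->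
  \sum_j trace_tensor lab x j * \prod_a u (lab a) (j a) =
  \prod_(i | odd (mult lab i)) \sum_y x i y * u i y.
Proof.
move=> u1; elim: k lab x => [|k IH] lab x.
  rewrite (@sum_index0 _ 1) => [|j]; last by rewrite big_ord0 mulr1.
  by rewrite big_pred0// => i; rewrite /mult big_ord0.
rewrite sum_index_recl /=; set i0 := lab ord0.
have spikeS y j : \prod_a u (lab a) (index_cons y j a) =
    u i0 y * \prod_a u (tail_labels lab a) (j a).
  rewrite big_ord_recl index_cons0; congr (_ * _).
  by apply: eq_bigr => a _; rewrite index_consS.
have [od|od] := boolP (odd (mult (tail_labels lab) i0)); last first.
  rewrite (big_odd_recl_even _ od)/= -/i0 -IH mulr_suml; apply: eq_bigr => y _.
  rewrite mulr_sumr; apply: eq_bigr => j _.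
  by rewrite spikeS index_cons0 index_consK mulrACA.
(* The factor 1 is expanded as the sum of the u_i0(y)^2 to match the outer sum over [y]: one factor
   u_i0(y) sits at the first position, the partner supplies the other through the basis vector. *)
rewrite -[RHS]mul1r -[X in _ = X * _](u1 i0) mulr_suml; apply: eq_bigr => y _.
transitivity (u i0 y * \sum_j
    trace_tensor (tail_labels lab) (set_vec x i0 (basis_vec y)) j *
      \prod_a u (tail_labels lab a) (j a)).
  rewrite mulr_sumr; apply: eq_bigr => j _.
  by rewrite spikeS index_cons0 index_consK mulrCA.
rewrite IH (big_odd_recl_odd _ od)/= -/i0 /set_vec eqxx sum_basis_vec mulrA.
(* With its first position restored, class [i0] is even and absent from the product, so overriding
   [x] at [i0] is invisible. *)
congr (_ * _); apply: eq_bigr => i; rewrite odd_mult_recl.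
have [<-|//] := eqVneq i0 i; by rewrite /= -/i0 od.
Qed.

(** Each identity matrix has squared Frobenius norm d, and the leftover vectors multiply. *)
Lemma trace_tensor_norm k (lab : 'I_k -> L) (x : L -> 'I_d -> R) :
  \sum_j trace_tensor lab x j ^+ 2 =
  d%:R ^+ npairs lab * \prod_(i | odd (mult lab i)) \sum_y x i y ^+ 2.
Proof.
elim: k lab x => [|k IH] lab x.
  rewrite (@sum_index0 _ 1) => [|j]; last by rewrite expr1n.
  by rewrite mul1r big_pred0// => i; rewrite /mult big_ord0.
rewrite sum_index_recl /=; set i0 := lab ord0.
have [od|od] := boolP (odd (mult (tail_labels lab) i0)); last first.
  rewrite (big_odd_recl_even _ od)/= -/i0 mulrCA -IH mulr_suml.
  apply: eq_bigr => y _; rewrite mulr_sumr; apply: eq_bigr => j _.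
  by rewrite index_cons0 index_consK exprMn.
(* One factor d is spread over the d values of [y], which all contribute equally. *)
rewrite exprS -mulrA mulr_natl -[X in _ *+ X]card_ord -sumr_const.
apply: eq_bigr => y _.
transitivity (\sum_j
    trace_tensor (tail_labels lab) (set_vec x i0 (basis_vec y)) j ^+ 2).
  by apply: eq_bigr => j _; rewrite index_cons0 index_consK.
rewrite IH (big_odd_recl_odd _ od)/= -/i0 /set_vec eqxx; congr (_ * _).
rewrite (eq_bigr (fun z => basis_vec y z * 1)) => [|z _]; last first.
  by rewrite /basis_vec; case: (z == y); rewrite ?expr1n ?expr0n/= mulr1.
rewrite sum_basis_vec mul1r; apply: eq_bigr => i; rewrite odd_mult_recl.
have [<-|//] := eqVneq i0 i; by rewrite /= -/i0 od.
Qed.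
End partial_trace.

(** * Rank-one tensors built from unit vectors *)

Section spikes.
Context {R : realType} {k d : nat}.
Implicit Types (L : finType).

Definition unit_family L (u : L -> 'I_d -> R) : Prop :=
  forall i, \sum_y u i y ^+ 2 = 1.

Definition rank_one L (lab : 'I_k -> L) (u : L -> 'I_d -> R)
    (j : {ffun 'I_k -> 'I_d}) : R := \prod_a u (lab a) (j a).

Definition dot (f g : 'I_d -> R) : R := \sum_y f y * g y.

Lemma sum_prod_dot (I : finType) (u v : I -> 'I_d -> R) :
  \sum_(j : {ffun I -> 'I_d}) (\prod_i u i (j i)) * (\prod_i v i (j i)) =
  \prod_i dot (u i) (v i).
Proof. by rewrite bigA_distr_bigA; apply: eq_bigr => j _; rewrite -big_split. Qed.

Lemma rank_one_dot L (lab : 'I_k -> L) (u v : L -> 'I_d -> R) :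
  \sum_j rank_one lab u j * rank_one lab v j = \prod_a dot (u (lab a)) (v (lab a)).
Proof. exact: (sum_prod_dot (u \o lab) (v \o lab)). Qed.

Lemma dot_unit L (u : L -> 'I_d -> R) i : unit_family u -> dot (u i) (u i) = 1.
Proof. by move=> u1; rewrite -(u1 i); apply: eq_bigr => y _; rewrite expr2. Qed.

Lemma rank_one_norm L (lab : 'I_k -> L) (u : L -> 'I_d -> R) :
  unit_family u -> \sum_j rank_one lab u j ^+ 2 = 1.
Proof.
move=> u1; under eq_bigr do rewrite expr2.
by rewrite rank_one_dot big1// => a _; exact: dot_unit.
Qed.

Lemma dot_le1 (f g : 'I_d -> R) :
  \sum_y f y ^+ 2 = 1 -> \sum_y g y ^+ 2 = 1 -> `|dot f g| <= 1.
Proof. by move=> f1 g1; apply: sum_mul_le1; rewrite ?f1 ?g1. Qed.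

Lemma basis_vec_norm (y : 'I_d) : \sum_z basis_vec y z ^+ 2 = 1 :> R.
Proof.
rewrite -(sum_basis_vec y (fun=> 1)); apply: eq_bigr => z _.
by rewrite /basis_vec; case: (z == y); rewrite ?expr1n ?expr0n/= mulr1.
Qed.

(** Since d^(k/2) is the k-th power of sqrt d, the normalization of the mean can be shared out among
    the k factors, making every vector a unit vector. *)
Lemma spiked_lawsE K (pi : 'I_k -> 'I_K) (D : probability (tensor R k d) R) :
  (0 < d)%N -> spiked_laws pi D ->
  exists2 u, unit_family u & D = normal_tensor (rank_one pi u).
Proof.
move=> d0 [v vnorm ->].
have sqd : 0 < Num.sqrt (d%:R : R) by rewrite sqrtr_gt0 ltr0n.
exists (fun i y => v i 0 y / Num.sqrt d%:R).
  move=> i; under eq_bigr do rewrite exprMn.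
  have := congr1 (fun x => x ^+ 2) (vnorm i).
  rewrite /vec_norm !sqr_sqrtr ?sum_sqr_ge0// -mulr_suml exprVn => ->.
  by rewrite sqr_sqrtr// divff// pnatr_eq0 -lt0n.
rewrite gaussian_tensorE; congr normal_tensor; apply/funext => j.
rewrite /spike tensor_ofE /rank_one big_split/= prodr_const card_ord.
by rewrite [k%:R / 2]mulrC powRrM powR12_sqrt// powR_mulrn ?sqrtr_ge0// exprVn.
Qed.
End spikes.

Lemma sum_sqrB (R : realDomainType) (J : finType) (f g : J -> R) :
  \sum_j (f j - g j) ^+ 2 =
  \sum_j f j ^+ 2 + \sum_j g j ^+ 2 - 2 * \sum_j f j * g j.
Proof.
by rewrite -big_split mulr_sumr -sumrB /=; apply: eq_bigr => j _; ring.
Qed.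

Lemma big_option_cond (T : Type) (idx : T) (op : Monoid.com_law idx) (L : finType)
    (P : pred (option L)) (F : option L -> T) : P None ->
  \big[op/idx]_(l | P l) F l =
  op (F None) (\big[op/idx]_(i | P (Some i)) F (Some i)).
Proof.
move=> PN; rewrite (bigD1 None)//=; congr (op _ _).
rewrite (reindex_omap (Some : L -> option L) id)/=; last by case=> // /andP[].
by apply: eq_bigl => i; rewrite eqxx !andbT.
Qed.

(** * The functionals for the odd classes and for the pairs *)

Section functionals.
Context {R : realType} {k d K : nat} (pi : 'I_k -> 'I_K).
Implicit Types (u v w : 'I_K -> 'I_d -> R).

Definition odd_class : pred 'I_K := [pred i | odd (mult pi i)].

Local Notation odd_index := {i : 'I_K | i \in odd_class}.

(** A multi-index only ranges over the odd classes; zero is a default value at even classes, whose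
    positions are all paired. *)
Definition odd_coords (alpha : {ffun odd_index -> 'I_d}) (i : 'I_K) : 'I_d -> R :=
  if insub i is Some i' then basis_vec (alpha i') else fun=> 0.

Definition odd_functional alpha : {ffun 'I_k -> 'I_d} -> R :=
  trace_tensor pi (odd_coords alpha).

Lemma odd_functional_norm alpha :
  \sum_j odd_functional alpha j ^+ 2 = d%:R ^+ npairs pi.
Proof.
rewrite trace_tensor_norm big1 ?mulr1// => i odd_i.
by rewrite /odd_coords insubT; exact: basis_vec_norm.
Qed.

Lemma odd_functional_spike u alpha : unit_family u ->
  \sum_j odd_functional alpha j * rank_one pi u j =
  \prod_(i : odd_index) u (\val i) (alpha i).
Proof.
move=> u1; rewrite trace_tensor_spike//.
rewrite (big_sub odd_class) /=; apply: eq_bigr => i _.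
by rewrite /odd_coords valK sum_basis_vec.
Qed.

Lemma sum_odd_prod_dot u v :
  \sum_(alpha : {ffun odd_index -> 'I_d})
    (\prod_(i : odd_index) u (\val i) (alpha i)) *
    (\prod_(i : odd_index) v (\val i) (alpha i)) =
  \prod_(i | odd (mult pi i)) dot (u i) (v i).
Proof.
rewrite (big_sub odd_class)/=.
exact: (sum_prod_dot (fun i : odd_index => u (\val i)) (fun i => v (\val i))).
Qed.

Lemma odd_functional_sqr u : unit_family u ->
  \sum_alpha (\sum_j odd_functional alpha j * rank_one pi u j) ^+ 2 = 1.
Proof.
move=> u1; under eq_bigr do rewrite odd_functional_spike// expr2.
by rewrite sum_odd_prod_dot big1// => i _; exact: dot_unit.
Qed.

(** After tracing, both spikes are unit tensors whose inner product factors over the odd classes. *)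
Lemma odd_functional_dist u v : unit_family u -> unit_family v ->
  \sum_alpha (\sum_j odd_functional alpha j * rank_one pi u j -
              \sum_j odd_functional alpha j * rank_one pi v j) ^+ 2 =
  2 - 2 * \prod_(i | odd (mult pi i)) dot (u i) (v i).
Proof.
move=> u1 v1; rewrite sum_sqrB !odd_functional_sqr//; congr (_ - 2 * _).
rewrite -sum_odd_prod_dot; apply: eq_bigr => alpha _.
by rewrite !odd_functional_spike.
Qed.

(* Giving a0 a label of its own, when its class is even, leaves exactly two
   positions of that class unpaired: a0 and one more. *)
Definition split_label (a0 a : 'I_k) : option 'I_K :=
  if a == a0 then None else Some (pi a).

(** The two open positions of the class of [a0] read the entry (y, z): [None] is [a0] itself, the
    label [pi a0] its counterpart. The remaining odd classes are contracted with [w]. *)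
Definition pair_coords w a0 (y z : 'I_d) (l : option 'I_K) : 'I_d -> R :=
  if l is Some i then (if i == pi a0 then basis_vec y else w i) else basis_vec z.

Definition pair_functional w a0 y z : {ffun 'I_k -> 'I_d} -> R :=
  trace_tensor (split_label a0) (pair_coords w a0 y z).

Lemma mult_split_None a0 : mult (split_label a0) None = 1%N.
Proof.
rewrite /mult (bigD1 a0)//= /split_label eqxx/= big1 ?addn0// => a /negbTE ->.
by [].
Qed.

Lemma mult_split_Some a0 i :
  mult pi i = ((pi a0 == i) + mult (split_label a0) (Some i))%N.
Proof.
rewrite /mult (bigD1 a0)//= [in RHS](bigD1 a0)//= /split_label eqxx add0n.
by congr addn; apply: eq_bigr => a /negbTE ->.
Qed.

Lemma big_odd_split a0 (T : Type) (idx : T) (op : Monoid.com_law idx)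
    (F : option 'I_K -> T) : ~~ odd (mult pi (pi a0)) ->
  \big[op/idx]_(l | odd (mult (split_label a0) l)) F l =
  op (F None) (op (F (Some (pi a0)))
    (\big[op/idx]_(i | odd (mult pi i)) F (Some i))).
Proof.
move=> ev; rewrite big_option_cond ?mult_split_None//.
congr (op _ _); rewrite (bigD1 (pi a0))/=; last first.
  by move: ev; rewrite (mult_split_Some a0) eqxx /= negbK.
congr (op _ _); apply: eq_bigl => i; rewrite (mult_split_Some a0 i).
have [<-|_] := eqVneq (pi a0) i; last by rewrite andbT.
by move: ev; rewrite (mult_split_Some a0) eqxx /= andbF => /negbTE.
Qed.

(** Splitting creates two odd classes among the same k positions, which by [npairsE] costs exactly
    one pair. *)
Lemma npairs_split a0 : ~~ odd (mult pi (pi a0)) ->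
  npairs pi = (npairs (split_label a0)).+1.
Proof.
move=> ev; have := npairsE pi; have := npairsE (split_label a0).
rewrite (big_odd_split addn (fun=> 1%N) ev)/=. 
move: (\sum_(i | odd (mult pi i)) 1)%N => S; lia.
Qed.

Lemma pair_functional_norm w a0 y z : unit_family w ->
  ~~ odd (mult pi (pi a0)) ->
  \sum_j pair_functional w a0 y z j ^+ 2 = d%:R ^+ (npairs pi).-1.
Proof.
move=> w1 ev; rewrite trace_tensor_norm (npairs_split ev)/=.
rewrite big1 ?mulr1// => -[i|] _ /=; last exact: basis_vec_norm.
by case: ifP => _; [exact: basis_vec_norm|exact: w1].
Qed.

Lemma pair_functional_spike w u a0 y z : unit_family u ->
  ~~ odd (mult pi (pi a0)) ->
  \sum_j pair_functional w a0 y z j * rank_one pi u j =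
  \prod_(i | odd (mult pi i)) dot (w i) (u i) * (u (pi a0) y * u (pi a0) z).
Proof.
(* [u'] gives the new label the vector of the class it was split from, so the spike is unchanged
   under the split labelling. *)
move=> u1 ev; pose u' (l : option 'I_K) := u (odflt (pi a0) l).
have u'1 : unit_family u' by case=> [i|]; exact: u1.
transitivity (\sum_j pair_functional w a0 y z j * rank_one (split_label a0) u' j).
  apply: eq_bigr => j _; congr (_ * _); apply: eq_bigr => a _.
  by rewrite /u' /split_label; case: eqP => //= ->.
rewrite trace_tensor_spike// (big_odd_split _ _ ev)/= eqxx !sum_basis_vec /u'/=.
set c := \prod_(i | _) dot _ _.
rewrite (_ : \prod_(i | _) _ = c); first by ring.
apply: eq_bigr => i odd_i.
by case: eqP => // ei; rewrite -ei odd_i in ev.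
Qed.

(** The functionals read off the matrices cu u u^T and cv v v^T, and the inner product of u u^T with
    v v^T is the squared overlap. *)
Lemma pair_functional_dist w u v a0 : unit_family u -> unit_family v ->
  ~~ odd (mult pi (pi a0)) ->
  let cu := \prod_(i | odd (mult pi i)) dot (w i) (u i) in
  let cv := \prod_(i | odd (mult pi i)) dot (w i) (v i) in
  \sum_(p : 'I_d * 'I_d)
    (\sum_j pair_functional w a0 p.1 p.2 j * rank_one pi u j -
     \sum_j pair_functional w a0 p.1 p.2 j * rank_one pi v j) ^+ 2 =
  cu ^+ 2 + cv ^+ 2 - 2 * (cu * cv * dot (u (pi a0)) (v (pi a0)) ^+ 2).
Proof.
move=> u1 v1 ev cu cv.
under eq_bigr do rewrite !pair_functional_spike// -/cu -/cv.
have dotE (f g : 'I_d -> R) (a b : R) :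
    \sum_(p : 'I_d * 'I_d) (a * (f p.1 * f p.2)) * (b * (g p.1 * g p.2)) =
    a * b * dot f g ^+ 2.
  rewrite expr2 /dot mulr_suml mulr_sumr -(pair_bigA _ (fun y z =>
    (a * (f y * f z)) * (b * (g y * g z))))/=.
  apply: eq_bigr => y _; rewrite !mulr_sumr.
  by apply: eq_bigr => z _; ring.
have sqrE (f : 'I_d -> R) (a : R) : \sum_y f y ^+ 2 = 1 ->
    \sum_(p : 'I_d * 'I_d) (a * (f p.1 * f p.2)) ^+ 2 = a ^+ 2.
  move=> f1; have ff : dot f f = 1.
    by rewrite -f1; apply: eq_bigr => y _; rewrite expr2.
  under eq_bigr do rewrite expr2.
  by rewrite dotE ff expr1n mulr1 expr2.
by rewrite sum_sqrB !sqrE// dotE.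
Qed.
End functionals.

(** * The algorithms *)

(** Individual signs are unknown, but the product over positions splits into one factor per odd
    class, controlled as a whole, and squares. In an odd class the square is close to 1 because the
    other overlaps have absolute value at most 1. *)
Lemma prod_overlap_ge (R : realFieldType) k K (pi : 'I_k -> 'I_K) (rho : 'I_K -> R)
    (eta : R) : 0 <= eta -> 2 * eta <= 1 ->
  (forall i, `|rho i| <= 1) ->
  1 - eta <= \prod_(i | odd (mult pi i)) rho i ->
  (forall a, ~~ odd (mult pi (pi a)) -> 1 - eta <= rho (pi a) ^+ 2) ->
  1 - (2 * k%:R + 1) * eta <= \prod_a rho (pi a).
Proof.
move=> eta0 eta1 rho1 odd_ge even_ge.
have sq_ge a : 1 - 2 * eta <= rho (pi a) ^+ 2.
  have [od|ev] := boolP (odd (mult pi (pi a))); last first.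
    by apply: le_trans (even_ge a ev); lra.
  have : \prod_(i | odd (mult pi i)) rho i <= `|rho (pi a)|.
    rewrite (le_trans (ler_norm _))// normr_prod (bigD1 (pi a))//=.
    by rewrite ler_piMr// prodr_ile1// => i _; rewrite normr_ge0 rho1.
  move=> h; have h' := le_trans odd_ge h.
  by rewrite -real_normK ?num_real//; have := normr_ge0 (rho (pi a)); nra.
have prodE (x : 'I_K -> R) : \prod_a x (pi a) = \prod_i x i ^+ mult pi i.
  rewrite (partition_big pi xpredT)//=; apply: eq_bigr => i _.
  rewrite (eq_bigr (fun=> x i)) => [|a /eqP ->//].
  by rewrite prodr_const /mult -sum1_card big_mkcond.
rewrite prodE.
have -> : \prod_i rho i ^+ mult pi i =
    \prod_(i | odd (mult pi i)) rho i * \prod_i (rho i ^+ 2) ^+ (mult pi i)./2.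
  rewrite [X in _ = X * _]big_mkcond -big_split/=; apply: eq_bigr => i _.
  rewrite -exprM mul2n -[in LHS](odd_double_half (mult pi i)) exprD.
  by case: odd.
have even_part : 1 - 2 * eta * k%:R <= \prod_i (rho i ^+ 2) ^+ (mult pi i)./2.
  (* One factor 1 - 2 eta per position is more than enough, since a class supplies only half its
     multiplicity in squares. *)
  apply: (@le_trans _ _ (\prod_(a < k) (1 - 2 * eta))).
    apply: le_trans (prod_ge_one_sub_sum _ _); last by move=> _; apply/andP; split; lra.
    by rewrite sumr_const card_ord -mulr_natr; lra.
  rewrite (prodE (fun=> 1 - 2 * eta)); apply: ler_prod => i _.
  rewrite exprn_ge0 /=; last by lra.
  have [m0|m_gt0] := posnP (mult pi i); first by rewrite m0.
  have [a ia] : exists a, pi a = i.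
    move: m_gt0; rewrite /mult lt0n sum_nat_eq0 negb_forall => /existsP[a].
    by rewrite implyTb eqb0 negbK => /eqP; exists a.
  rewrite -{}ia.
  apply: (@le_trans _ _ ((1 - 2 * eta) ^+ (mult pi (pi a))./2)).
    by rewrite ler_wiXn2l; [|lra|lra|rewrite -divn2 leq_div].
  by rewrite lerXn2r// nnegrE ?sqr_ge0//; lra.
set P := \prod_(i | _) _ in odd_ge *; set S := \prod_i _ in even_part *.
(* If this bound is not positive, neither is the claimed one, and nonnegativity of both factors
   suffices; otherwise the two bounds are multiplied. *)
have [k0|k0] := leP (1 - 2 * eta * k%:R) 0.
  have S0 : 0 <= S by apply: prodr_ge0 => i _; rewrite exprn_ge0// sqr_ge0.
  have : 0 <= P * S by rewrite mulr_ge0//; lra.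
  nra.
have := ler_pM _ (ltW k0) odd_ge even_part.
have := ler0n R k; nra.
Qed.

(** The gain d^eps eventually exceeds the hidden constant divided by [eta]; [c'] replaces that
    constant by a positive one. *)
Lemma muchless_eventually (R : realType) (f g : nat -> R) (eta : R) :
  (forall d, 0 <= f d) -> (forall d, 0 <= g d) -> 0 < eta -> muchless f g ->
  \forall d \near \oo, f d <= eta * g d.
Proof.
move=> f0 g0 eta0 [eps eps0 [c fg]].
pose c' : R := `|c| + 1; have c'0 : 0 < c' by rewrite ltr_wpDl.
pose x := (c' / eta) `^ eps^-1.
exists (Num.bound x).+1 => // d /= xd.
have d0 : (0 < d)%N by apply: leq_trans xd.
have xd' : x <= d%:R.
  have := archi_boundP (powR_ge0 (c' / eta) eps^-1); rewrite -/x => /ltW/le_trans; apply.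
  by rewrite ler_nat ltnW.
have : c' / eta <= d%:R `^ eps.
  have <- : x `^ eps = c' / eta.
    by rewrite /x -powRrM mulVf ?lt0r_neq0// powRr1// divr_ge0 ?ltW.
  by apply: ge0_ler_powR; rewrite ?nnegrE ?powR_ge0 ?(ltW eps0).
move=> h; have := ler_wpM2l (f0 d) h => /le_trans/(_ (fg d d0)).
move=> h2; have h3 : f d * (c' / eta) <= c' * g d.
  by apply: (le_trans h2); rewrite ler_wpM2r// /c'; have := ler_norm c; lra.
rewrite -(ler_pM2l c'0) mulrCA -ler_pdivrMl//; apply: le_trans h3.
by rewrite le_eqVlt; apply/orP; left; apply/eqP; field; rewrite gt_eqF.
Qed.

Section oddness.
Context {k K : nat} (pi : 'I_k -> 'I_K).

Lemma oddnessE : oddness pi = (\sum_(i | odd (mult pi i)) 1)%N.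
Proof.
have multE i : #|[set a | pi a == i]| = mult pi i.
  rewrite /mult -sum1_card [in LHS]big_mkcond; apply: eq_bigr => a _.
  by rewrite /in_mem /= /in_set /= asboolb; case: eqP.
rewrite /oddness -sum1_card; apply: eq_bigl => i.
by rewrite /in_mem /= /in_set /= asboolb multE.
Qed.

Lemma npairs_oddness : ((npairs pi).*2 + oddness pi)%N = k.
Proof. by rewrite oddnessE npairsE. Qed.

Lemma card_odd_coords d :
  #|{: {ffun {i : 'I_K | i \in odd_class pi} -> 'I_d}}| = (d ^ oddness pi)%N.
Proof.
by rewrite card_ffun card_ord card_sig oddnessE sum1_card.
Qed.
End oddness.

Lemma rank_one_norm_le1 (R : realType) k d (L : finType) (lab : 'I_k -> L)
    (u : L -> 'I_d -> R) : unit_family u -> \sum_j rank_one lab u j ^+ 2 <= 1.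
Proof. by move=> u1; rewrite rank_one_norm. Qed.

Section algorithms.
Context {R : realType} {k d K : nat} (pi : 'I_k -> 'I_K).
Local Notation J := {ffun 'I_k -> 'I_d}.
Variables (C : R) (Q : (J -> R) -> query R k d).
Hypothesis C_gt0 : 0 < C.
Hypothesis QP : forall (W m m' : J -> R),
  \sum_j m j ^+ 2 <= 1 -> \sum_j m' j ^+ 2 <= 1 ->
  `|\sum_j W j * m j - \sum_j W j * m' j| <=
  C * l2 W * `|mean (normal_tensor m) (Q W) - mean (normal_tensor m') (Q W)|.
Variables (n : nat) (n_gt0 : (0 < n)%N).

(** Two means that fit the same answers have query means within twice the tolerance, by the triangle
    inequality through the answer. [QP] converts this into a bound for each functional, and the
    squares add up. *)
Lemma consistent_dist (I : finType) (W : I -> J -> R) (N : R) (a : I -> R)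
    (m m' : J -> R) :
  \sum_j m j ^+ 2 <= 1 -> \sum_j m' j ^+ 2 <= 1 ->
  (forall i, \sum_j W i j ^+ 2 = N) ->
  (forall i, consistent (normal_tensor m) n (Q \o W) a i) ->
  (forall i, consistent (normal_tensor m') n (Q \o W) a i) ->
  \sum_i (\sum_j W i j * m j - \sum_j W i j * m' j) ^+ 2 <=
  4 * C ^+ 2 * (#|I|%:R * N / n%:R).
Proof.
move=> m1 m'1 WN cm cm'.
apply: (@le_trans _ _ (\sum_(i : I) 4 * C ^+ 2 * (N / n%:R))); last first.
  by rewrite sumr_const -mulr_natl le_eqVlt; apply/orP; left; apply/eqP; ring.
apply: ler_sum => i _; rewrite -real_normK ?num_real//.
have tol2 : tolerance n ^+ 2 = n%:R^-1 :> R by rewrite sqr_sqrtr// invr_ge0.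
have N2 : l2 (W i) ^+ 2 = N by rewrite sqr_sqrtr ?sum_sqr_ge0 ?WN.
have -> : 4 * C ^+ 2 * (N / n%:R) = (C * l2 (W i) * (2 * tolerance n)) ^+ 2.
  by rewrite !exprMn N2 tol2; ring.
rewrite ler_sqr ?nnegrE ?mulr_ge0 ?sqrtr_ge0 ?(ltW C_gt0)//.
apply: (le_trans (QP (W i) m1 m'1)); apply: ler_wpM2l.
  by rewrite mulr_ge0 ?sqrtr_ge0// ltW.
have h1 := cm i; have h2 := cm' i; rewrite /consistent /= in h1 h2.
apply: le_trans (ler_distD (a i) _ _) _; rewrite [X in X + _]distrC; lra.
Qed.

Local Notation odd_query := (Q \o @odd_functional R k d K pi).
Local Notation pair_query w := (Q \o (fun p : 'I_k * ('I_d * 'I_d) =>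
  @pair_functional R k d K pi w p.1 p.2.1 p.2.2)).
Local Notation odd_answers := ({ffun {i : 'I_K | i \in odd_class pi} -> 'I_d} -> R).

(** Depends on the answers and not on the unknown law, so an algorithm may select from it. *)
Definition fits_odd (a : odd_answers) : set ('I_K -> 'I_d -> R) :=
  [set u | unit_family u /\
    forall alpha, consistent (normal_tensor (rank_one pi u)) n odd_query a alpha].

Definition fits_pairs w (b : 'I_k * ('I_d * 'I_d) -> R) : set ('I_K -> 'I_d -> R) :=
  [set u | unit_family u /\
    forall p, consistent (normal_tensor (rank_one pi u)) n (pair_query w) b p].

Definition test : sq_algorithm R k d verdict :=
  ask odd_query (enum {: {ffun {i : 'I_K | i \in odd_class pi} -> 'I_d}})
    (fun a => Return (if `[< forall alpha, consistent null_law n odd_query a alpha >]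
                        then Null else Spiked)) (fun=> 0).

(** The second batch is adaptive: its functionals contain the [w] selected from the first answers.
    The zero family is the default of [xget] when no candidate fits. *)
Definition estimate : sq_algorithm R k d (tensor R k d) :=
  ask odd_query (enum {: {ffun {i : 'I_K | i \in odd_class pi} -> 'I_d}})
    (fun a => let w := xget (fun _ _ => 0) (fits_odd a) in
      ask (pair_query w) (enum {: 'I_k * ('I_d * 'I_d)})
        (fun b => Return (tensor_of (rank_one pi
           (xget (fun _ _ => 0) (fits_odd a `&` fits_pairs w b))))) (fun=> 0))
    (fun=> 0).

(** There are d^o functionals of squared norm d^p, whence the exponent o + p. *)
Lemma fits_odd_overlap (a : odd_answers) u v : fits_odd a u -> fits_odd a v ->
  1 - \prod_(i | odd (mult pi i)) dot (u i) (v i) <=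
  2 * C ^+ 2 * (d%:R ^+ (oddness pi + npairs pi) / n%:R).
Proof.
move=> [u1 cu] [v1 cv].
have := consistent_dist (rank_one_norm_le1 pi u1) (rank_one_norm_le1 pi v1)
  (@odd_functional_norm R k d K pi) cu cv.
rewrite odd_functional_dist// card_odd_coords natrX -exprD; lra.
Qed.

(** With both factors at least 1/2, the squared distance is at least 2 cu cv (1 - rho^2) >= (1 -
    rho^2) / 2. It is estimated through d^2 functionals of squared norm d^(p - 1). *)
Lemma fits_pairs_overlap w b u v a0 : unit_family w ->
  fits_pairs w b u -> fits_pairs w b v -> ~~ odd (mult pi (pi a0)) ->
  2^-1 <= \prod_(i | odd (mult pi i)) dot (w i) (u i) ->
  2^-1 <= \prod_(i | odd (mult pi i)) dot (w i) (v i) ->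
  1 - dot (u (pi a0)) (v (pi a0)) ^+ 2 <=
  8 * C ^+ 2 * (d%:R ^+ (npairs pi).+1 / n%:R).
Proof.
move=> w1 [u1 cu] [v1 cv] ev.
set cwu := \prod_(i | _) _; set cwv := \prod_(i | _) _ => hu hv.
have := consistent_dist (W := fun p => pair_functional pi w a0 p.1 p.2)
  (rank_one_norm_le1 pi u1) (rank_one_norm_le1 pi v1)
  (fun p => pair_functional_norm p.1 p.2 w1 ev)
  (fun p => cu (a0, p)) (fun p => cv (a0, p)).
rewrite pair_functional_dist// -/cwu -/cwv card_prod card_ord natrM -expr2 -exprD.
have -> : (2 + (npairs pi).-1 = (npairs pi).+1)%N by rewrite (npairs_split ev).
have rho1 := dot_le1 (u1 (pi a0)) (v1 (pi a0)).
set rho := dot _ _ in rho1 *.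
have rho2 : rho ^+ 2 <= 1 by rewrite -real_normK ?num_real// expr_le1.
set E := _ / n%:R.
have : (1 - rho ^+ 2) * 4^-1 <= (1 - rho ^+ 2) * (cwu * cwv).
  by rewrite ler_wpM2l ?subr_ge0//; nra.
have := sqr_ge0 (cwu - cwv); rewrite sqrrB; nra.
Qed.

(** A spike traces to a unit tensor and the null mean to zero. Were both to fit the answers, their
    squared distance 1 would lie below the resolution, which is less than 1. *)
Lemma test_solves (B : nat) : (d ^ oddness pi <= B)%N -> (0 < d)%N ->
  4 * C ^+ 2 * (d%:R ^+ (oddness pi + npairs pi) / n%:R) < 1 ->
  solves_testing pi n B test.
Proof.
move=> dB d0 small D DD O vO.
have [h [a [runE sz good]]] := run_ask odd_query
  (enum {: {ffun {i : 'I_K | i \in odd_class pi} -> 'I_d}})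
  (fun a => Return (if `[< forall alpha, consistent null_law n odd_query a alpha >]
                      then Null else Spiked)) (fun=> 0) [::] n_gt0 vO.
have fit alpha : consistent D n odd_query a alpha.
  by apply: good; left; rewrite mem_enum.
split; rewrite /queries /output /test runE/=.
- by rewrite sz add0n -cardE card_odd_coords.
- by move=> DE; rewrite asboolT// -DE.
move=> /(spiked_lawsE d0)[u u1 DE]; case: asboolP => // null_fit; exfalso.
have null1 : \sum_(j : J) (0 : R) ^+ 2 <= 1.
  by rewrite big1// => j _; rewrite expr0n.
rewrite DE in fit.
have := consistent_dist (rank_one_norm_le1 pi u1) null1
  (@odd_functional_norm R k d K pi) fit null_fit.
under eq_bigr => alpha _.
  rewrite [X in _ - X]big1 ?subr0; last by move=> j _; rewrite mulr0.
  over.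
rewrite odd_functional_sqr// card_odd_coords natrX -exprD; lra.
Qed.

Lemma estimate_solves (B : nat) (eta : R) :
  (d ^ oddness pi + k * d ^ 2 <= B)%N -> (0 < d)%N ->
  2 * eta <= 1 -> 32 * ((2 * k%:R + 1) * eta) <= 1 ->
  8 * C ^+ 2 * (d%:R ^+ (oddness pi + npairs pi) / n%:R) <= eta ->
  8 * C ^+ 2 * (d%:R ^+ (npairs pi).+1 / n%:R) <= eta ->
  solves_estimation pi n B estimate.
Proof.
move=> dB d0 eta_half eta32 small1 small2 D spD O vO.
have [u u1 DE] := spiked_lawsE d0 spD.
pose final a w b : sq_algorithm R k d (tensor R k d) := Return
  (tensor_of (rank_one pi (xget (fun _ _ => 0) (fits_odd a `&` fits_pairs w b)))).
have [h [a [runE sz good]]] := run_ask odd_query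
  (enum {: {ffun {i : 'I_K | i \in odd_class pi} -> 'I_d}})
  (fun a => let w := xget (fun _ _ => 0) (fits_odd a) in
      ask (pair_query w) (enum {: 'I_k * ('I_d * 'I_d)}) (final a w) (fun=> 0))
  (fun=> 0) [::] n_gt0 vO.
have ua : fits_odd a u.
  by split=> // alpha; rewrite -DE; apply: good; left; rewrite mem_enum.
have wa := xgetPex (fun _ _ => 0) (ex_intro _ u ua).
set w := xget _ _ in wa.
have [h' [b [runE' sz' good']]] := run_ask (pair_query w)
  (enum {: 'I_k * ('I_d * 'I_d)}) (final a w) (fun=> 0) h n_gt0 vO.
have ub : fits_pairs w b u.
  by split=> // p; rewrite -DE; apply: good'; left; rewrite mem_enum.
have := xgetPex (fun _ _ => 0) (ex_intro (fits_odd a `&` fits_pairs w b) u (conj ua ub)).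
set v := xget _ _ => -[va vb].
have run_estimate : run_from O [::] estimate = (h', tensor_of (rank_one pi v)).
  by rewrite /estimate runE /= -/w runE'.
have [[w1 _] [v1 _]] := (wa, va).
split; rewrite /queries /output run_estimate /=.
  rewrite sz' sz add0n -!cardE card_odd_coords !card_prod !card_ord.
  by rewrite mulnn.
have eta0 : 0 <= eta.
  apply: le_trans small2; rewrite mulr_ge0 ?divr_ge0 ?exprn_ge0//.
  by rewrite mulr_ge0// sqr_ge0.
have odd_ge x y : fits_odd a x -> fits_odd a y ->
    1 - eta <= \prod_(i | odd (mult pi i)) dot (x i) (y i).
  by move=> xa ya; have := fits_odd_overlap xa ya; have := sqr_ge0 C; nra.
have overlap : 1 - (2 * k%:R + 1) * eta <= \prod_i dot (v (pi i)) (u (pi i)).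
  apply: (prod_overlap_ge (rho := fun i => dot (v i) (u i))) => //.
  - by move=> i; apply: dot_le1; [exact: v1|exact: u1].
  - exact: odd_ge.
  (* [w], [u] and [v] all fit the odd answers, so both contraction factors are at least 1 - eta >=
     1/2. *)
  move=> a0 ev; have := fits_pairs_overlap w1 vb ub ev.
  have := odd_ge _ _ wa ua; have := odd_ge _ _ wa va.
  move=> h1 h2 h3; have := h3 _ _; lra.
(* The squared error is 2 minus twice the overlap, at most 2 (2 k + 1) eta <= 1/16. *)
rewrite /tensor_norm -[leRHS]ger0_norm// -sqrtr_sqr ler_wsqrtr//.
rewrite DE (eq_bigr (fun j => (rank_one pi v j - rank_one pi u j) ^+ 2)).
rewrite sum_sqrB !rank_one_norm// rank_one_dot; lra.
by move=> j _; rewrite tensor_ofE mean_normal_tensor tensor_ofE.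
Qed.
End algorithms.

(** * Query budgets and sample-size thresholds *)

Section complexity.
Context {R : realType} {k K : nat} (pi : 'I_k -> 'I_K) (n : nat -> nat).
Hypothesis n_gt0 : forall d, (0 < d)%N -> (0 < n d)%N.
Local Notation o := (oddness pi).
Local Notation p := (npairs pi).

(* The allowed budget d ^ k * ln (n d) vanishes when n d = 1, where the
   algorithms need not be correct. *)
Definition budget (d : nat) : nat :=
  if (n d <= 1)%N then 0%N else (k.+1 * d ^ k)%N.

Lemma query_budgetP : @query_budget R k n budget.
Proof.
(* Outside the zero-budget case n d >= 2, so ln (n d) >= ln 2 absorbs the factor k + 1. *)
exists (k.+1%:R / ln 2) => d d0.
have ln2 : 0 < ln 2 :> R by rewrite ln_gt0// ltr1n.
have dk0 : 0 <= d%:R ^+ k :> R by rewrite exprn_ge0.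
rewrite /budget; case: leqP => nd.
  rewrite mulr_ge0 ?divr_ge0 ?(ltW ln2)// mulr_ge0// ln_ge0// ler1n.
  exact: n_gt0.
have lnn : ln 2 <= ln (n d)%:R :> R.
  by rewrite ler_ln ?posrE ?ltr0n ?ler_nat// ltnW.
rewrite natrM natrX -mulrA ler_wpM2l// [leRHS]mulrCA ler_peMr//.
by rewrite mulrC ler_pdivlMr// mul1r.
Qed.

Lemma budget_ge d : (0 < d)%N -> (1 < n d)%N -> (2 <= k)%N ->
  (d ^ o + k * d ^ 2 <= budget d)%N.
Proof.
move=> d0 nd k2; rewrite /budget [(n d <= 1)%N]leqNgt nd /= mulSn leq_add//.
  by rewrite leq_pexp2l// -{2}(npairs_oddness pi) leq_addl.
by rewrite leq_mul2l leq_pexp2l ?orbT.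
Qed.

(** Since d^e >= 1 for d >= 1, the bound forces n d >= 2, the range where the budget is nonzero. *)
Lemma eventually_gt1 (e : nat) :
  (\forall d \near \oo, d%:R ^+ e <= 2^-1 * (n d)%:R :> R) ->
  \forall d \near \oo, (0 < d)%N /\ (1 < n d)%N.
Proof.
move=> small; near=> d; have d0 : (0 < d)%N by near: d; exact: nbhs_infty_gt.
split=> //; rewrite -(ltr_nat R).
have : d%:R ^+ e <= 2^-1 * (n d)%:R :> R by near: d.
have : 1 <= d%:R ^+ e :> R by rewrite exprn_ege1// ler1n.
lra.
Unshelve. all: by end_near. Qed.

Lemma scaled_small (c x y eta : R) : 0 < c -> 0 < y -> x <= eta / c * y ->
  c * (x / y) <= eta.
Proof.
move=> c0 y0; rewrite -ler_pdivrMr// => h.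
by rewrite -ler_pdivlMl// [leRHS]mulrC.
Qed.

Hypothesis k_ge2 : (2 <= k)%N.
Hypothesis small_odd : forall eta : R, 0 < eta ->
  \forall d \near \oo, d%:R ^+ (o + p) <= eta * (n d)%:R.

Lemma testable_small : testable R pi n.
Proof.
have [C C0 HQ] := @exists_query R.
exists (fun d => test pi (projT1 (choice (HQ k d))) (n d)), budget.
split; first exact: query_budgetP.
have C2 : 0 < 4 * C ^+ 2 by rewrite mulr_gt0// exprn_gt0.
have gt1 := eventually_gt1 (small_odd (ltac:(by rewrite invr_gt0) : 0 < 2^-1)).
have small := small_odd (divr_gt0 (ltac:(by rewrite invr_gt0) : 0 < 2^-1) C2).
near=> d; have [d0 nd] : (0 < d)%N /\ (1 < n d)%N by near: d.
apply: (test_solves C0 (projT2 (choice (HQ k d)))) => //; first exact: n_gt0.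
  by apply: leq_trans (budget_ge d0 nd k_ge2); rewrite leq_addr.
apply: (@le_lt_trans _ _ 2^-1); last by lra.
apply: scaled_small => //; first by rewrite ltr0n n_gt0.
by near: d.
Unshelve. all: by end_near. Qed.

Hypothesis small_pairs : forall eta : R, 0 < eta ->
  \forall d \near \oo, d%:R ^+ p.+1 <= eta * (n d)%:R.

Lemma estimable_small : estimable R pi n.
Proof.
have [C C0 HQ] := @exists_query R.
exists (fun d => estimate pi (projT1 (choice (HQ k d))) (n d)), budget.
split; first exact: query_budgetP.
have C2 : 0 < 8 * C ^+ 2 by rewrite mulr_gt0// exprn_gt0.
(* Largest value allowed by the final accuracy: 32 (2 k + 1) eta = 1. *)
pose eta : R := (32 * (2 * k%:R + 1))^-1.
have k0 : 0 <= k%:R :> R by [].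
have eta0 : 0 < eta by rewrite invr_gt0; lra.
have eta32 : 32 * ((2 * k%:R + 1) * eta) = 1.
  by rewrite /eta; field; rewrite gt_eqF; lra.
have gt1 := eventually_gt1 (small_odd (ltac:(by rewrite invr_gt0) : 0 < 2^-1)).
have small1 := small_odd (divr_gt0 eta0 C2).
have small2 := small_pairs (divr_gt0 eta0 C2).
near=> d; have [d0 nd] : (0 < d)%N /\ (1 < n d)%N by near: d.
apply: (estimate_solves C0 (projT2 (choice (HQ k d))) (n_gt0 d0) (eta := eta)) => //.
- exact: budget_ge.
- nra.
- by rewrite eta32.
- by apply: scaled_small => //; [rewrite ltr0n n_gt0|near: d].
- by apply: scaled_small => //; [rewrite ltr0n n_gt0|near: d].
Unshelve. all: by end_near. Qed.
End complexity.

Lemma sqrt_even_power (R : realType) (d m : nat) :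
  Num.sqrt (d%:R ^+ m.*2) = d%:R ^+ m :> R.
Proof. by rewrite -mul2n mulnC exprM sqrtr_sqr ger0_norm// exprn_ge0. Qed.

Theorem theorem2 (R : realType) (k K : nat) (pi : 'I_k -> 'I_K)
    (n : nat -> nat)
    (k_ge2 : (2 <= k)%N) (K_le_k : (K <= k)%N)
    (n_gt0 : forall d, (0 < d)%N -> (0 < n d)%N) :
  [/\ oddness pi = 0%N ->
        muchless (fun d => Num.sqrt (d%:R ^+ k) : R) (fun d => (n d)%:R) ->
        testable R pi n,
      oddness pi = 0%N ->
        muchless (fun d => Num.sqrt (d%:R ^+ (k + 2)) : R) (fun d => (n d)%:R) ->
        estimable R pi n &
      (1 <= oddness pi)%N ->
        muchless (fun d => Num.sqrt (d%:R ^+ (k + oddness pi)) : R)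
                 (fun d => (n d)%:R) ->
        testable R pi n /\ estimable R pi n].
Proof.
have kE := npairs_oddness pi.
(* All three thresholds are square roots of even powers, since k = 2 p + o: the exponent [m] is p,
   then p + 1, then p + o. *)
have small (m : nat) : muchless (fun d => Num.sqrt (d%:R ^+ m.*2) : R)
    (fun d => (n d)%:R) -> forall e, (e <= m)%N -> forall eta : R, 0 < eta ->
    \forall d \near \oo, d%:R ^+ e <= eta * (n d)%:R.
  move=> nm e em eta eta0.
  have small_m := muchless_eventually (fun d => sqrtr_ge0 _) (fun d => ler0n R _) eta0 nm.
  near=> d; have d0 : (0 < d)%N by near: d; exact: nbhs_infty_gt.
  apply: (@le_trans _ _ (d%:R ^+ m)); first by rewrite ler_weXn2l ?ler1n.
  by rewrite -sqrt_even_power; near: d.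
split=> [od0|od0|od1].
- rewrite -{1}kE od0 addn0 => /small sm.
  by apply: testable_small => // eta eta0; apply: sm => //; rewrite od0.
- rewrite -{1}kE od0 addn0 addn2 -doubleS => /small sm.
  apply: estimable_small => // eta eta0; apply: sm => //.
  by rewrite od0.
- rewrite -{1}kE -addnA addnn -doubleD => /small sm.
  have small_odd (eta : R) : 0 < eta ->
      \forall d \near \oo, d%:R ^+ (oddness pi + npairs pi) <= eta * (n d)%:R.
    by move=> eta0; apply: sm => //; rewrite addnC.
  split; first exact: testable_small.
  apply: estimable_small => // eta eta0; apply: sm => //.
  (* Here o >= 1 gives p + 1 <= p + o, so the threshold for the odd classes also covers the
     pairs. *)
  by rewrite -addn1 leq_add2l.
Unshelve. all: by end_near. Qed.
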